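(* Let $d\ge 1$, $T\ge 1$, let $K_t^j\subseteq\mathbb R$ ($j=1,\dots,d$, $t=0,\dots,T$) be closed sets, $\Omega=\prod_{t=0}^T\prod_{j=1}^d K_t^j$, and let $\mathcal E=\mathcal E_0\times\dots\times\mathcal E_T$, $U$, $V$, $\mathcal A$, $S^U$, $\mathcal D$, $\mathfrak P$ be as in the context. Assume: (i) $U:\mathcal E\to[-\infty,+\infty)$ is concave with $U(0)\in\mathbb R$, and $\mathcal A\subseteq C_{0:T}$ is a convex cone with $0\in\mathcal A$; (ii) for every $t=0,\dots,T$ there exist compact sets $\mathfrak K_t(n)\subseteq\prod_{j=1}^dK_t^j$ and functions $0\le f_t^n\in\mathcal E_t$, $n\ge 1$, such that $1+\sum_{t=0}^T\sum_{j=1}^d|x_t^j|\le\sum_{t=0}^T f_t^n(x_0,\dots,x_t)$ for all $x\in\Omega\setminus(\mathfrak K_0(n)\times\dots\times\mathfrak K_T(n))$, and $V(\Gamma f_0^n,\dots,\Gamma f_T^n)\to 0$ as $n\to\infty$ for every real $\Gamma>0$. Then: (a) If $\mathfrak P(\widehat c)<+\infty$ for some $\widehat c\in B_{0:T}$, then $\mathfrak P(c)\in\mathbb R$ for every $c\in B_{0:T}$, and $\mathfrak P:B_{0:T}\to\mathbb R$ is norm continuous, cash additive ($\mathfrak P(c+k)=\mathfrak P(c)+k$ for $k\in\mathbb R$), concave and nondecreasing on $B_{0:T}$. (b) For every lower semicontinuous $c:\Omega\to(-\infty,+\infty]$ such that $c(x)\ge -A\big(1+\sum_{t=0}^T\sum_{j=1}^d|x_t^j|\big)$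 for all $x\in\Omega$ and some $A\in[0,+\infty)$, we have $$\mathfrak P(c)=\inf_{Q\in\mathrm{Prob}^1(\Omega)\cap\mathcal A^\circ}\big(E_Q[c]+\mathcal D(Q)\big),$$ (with $\inf\emptyset=+\infty$), where $\mathcal D(Q)=\sup_{\varphi\in\mathcal E}\big(U(\varphi)-\sum_{t=0}^T\int_{\Omega_{0:t}}\varphi_t\,dQ_t\big)=\sup_{\varphi\in\mathcal E}\big(\sum_{t=0}^T\int_{\Omega_{0:t}}\varphi_t\,dQ_t-V(\varphi)\big)$. Furthermore, if $\mathfrak P(c)<+\infty$ the infimum is a minimum.
   Context: For $0\le t\le T$, $\Omega_{0:t}=\prod_{s=0}^t\prod_{j=1}^dK_s^j$; points $x=(x_0,\dots,x_T)\in\Omega$ with $x_t=(x_t^1,\dots,x_t^d)$. $C_{0:t}$ is the space of continuous $\phi:\Omega_{0:t}\to\mathbb R$ with $\|\phi\|_{0:t}:=\sup_{x}\frac{|\phi(x)|}{1+\sum_{s=0}^t\sum_{j=1}^d|x_s^j|}<\infty$; elements of $C_{0:t}$ are also regarded as functions on $\Omega$ depending only on $(x_0,\dots,x_t)$. $B_{0:T}$ is defined as $C_{0:T}$ but with Borel measurable instead of continuous functions, normed by $\|\cdot\|_{0:T}$. $(C_{0:T})^*$ is the topological dual of $C_{0:T}$. $\mathrm{Prob}^1(\Omega)$ is the set of Borel probability measures $Q$ on $\Omega$ with $\int|x_t^j|\,dQ<\infty$ for all $j,t$; such $Q$ is identified with the functional $c\mapsto E_Q[c]$ on $C_{0:T}$,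 and $Q_t$ is its marginal on $\Omega_{0:t}$. $\mathcal E_t$ are vector subspaces with $\mathbb R\subseteq\mathcal E_t\subseteq C_{0:t}$, $\mathcal E=\mathcal E_0\times\dots\times\mathcal E_T$, $U:\mathcal E\to[-\infty,+\infty)$, $V(\varphi):=-U(-\varphi)$. $S^U(\varphi):=\sup_{\beta\in\mathbb R^{T+1}}\big(U(\varphi+\beta)-\sum_{t=0}^T\beta_t\big)$ (componentwise addition) and $\mathrm{dom}(S^U)=\{\varphi\in\mathcal E:S^U(\varphi)>-\infty\}$. The polar of $\mathcal A$ is $\mathcal A^\circ=\{\lambda\in(C_{0:T})^*:\langle z,\lambda\rangle\le 0\ \forall z\in\mathcal A\}$; thus $Q\in\mathrm{Prob}^1(\Omega)\cap\mathcal A^\circ$ means $E_Q[z]\le0$ for all $z\in\mathcal A$. For measurable $c$ and $z\in-\mathcal A$, $\Phi_z(c)=\{\varphi\in\mathrm{dom}(S^U):\sum_{t=0}^T\varphi_t(x_0,\dots,x_t)+z(x)\le c(x)\ \forall x\in\Omega\}$ and $\mathfrak P(c)=\sup_{z\in-\mathcal A}\sup_{\varphi\in\Phi_z(c)}S^U(\varphi)\in[-\infty,+\infty]$, with $\sup\emptyset=-\infty$. *)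

(* Defs.v *)
From HB Require Import structures.
From mathcomp Require Import all_boot all_order all_algebra.
From mathcomp Require Import all_classical all_reals all_analysis.
Unset Printing Implicit Defensive.
Import Order.TTheory GRing.Theory Num.Theory.
Import numFieldNormedType.Exports.
Local Open Scope classical_set_scope.
Local Open Scope ring_scope.

(* A point x = (x_0,...,x_T) with x_t = (x_t^1,...,x_t^d) is a matrix
   x : 'M[R]_(T.+1, d), x t j = x_t^{j+1}.  A point (x_0,...,x_t) of
   Omega_{0:t} is a matrix 'M[R]_(t.+1, d). *)

Definition wt {R : realType} {m d : nat} (y : 'M[R]_(m, d)) : R :=
  1 + \sum_(i < m) \sum_(j < d) `|y i j|.

Definition Omt {R : realType} {T d : nat} (K : 'I_T.+1 -> 'I_d -> set R)
    (m : nat) : set 'M[R]_(m, d) :=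
  [set y | forall (i : 'I_m) (j : 'I_d), K (inord i) j (y i j)].

Definition Om {R : realType} {T d : nat} (K : 'I_T.+1 -> 'I_d -> set R) :
  set 'M[R]_(T.+1, d) := Omt K T.+1.

(* C_{0:t}: continuous functions on a set S (represented canonically by their
   extension by 0 outside S) with finite weighted sup norm. *)
Definition Cw {R : realType} {m d : nat} (S : set 'M[R]_(m, d)) :
    set ('M[R]_(m, d) -> R) :=
  [set psi | {within S, continuous psi} /\ (forall y, ~ S y -> psi y = 0) /\
             exists C : R, forall y, S y -> `|psi y| <= C * wt y].

Definition Borel (R : realType) (T d : nat) :=
  g_sigma_algebraType (@open 'M[R]_(T.+1, d)).

(* B_{0:T}: Borel measurable functions on Omega with finite weighted norm
   (values outside Omega are irrelevant). *)
Definition Bw {R : realType} {T d : nat} (K : 'I_T.+1 -> 'I_d -> set R) :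
    set ('M[R]_(T.+1, d) -> R) :=
  [set c | measurable_fun (Om K : set (Borel R T d)) (c : Borel R T d -> R) /\
           exists C : R, forall x, Om K x -> `|c x| <= C * wt x].

Definition wnorm {R : realType} {T d : nat} (K : 'I_T.+1 -> 'I_d -> set R)
    (c : 'M[R]_(T.+1, d) -> R) : \bar R :=
  ereal_sup [set (`|c x| / wt x)%:E | x in Om K].

Definition Phi (R : realType) (T d : nat) :=
  forall t : 'I_T.+1, 'M[R]_(t.+1, d) -> R.

Definition projt {R : realType} {T d : nat} (t : 'I_T.+1)
    (x : 'M[R]_(T.+1, d)) : 'M[R]_(t.+1, d) :=
  \matrix_(i < t.+1, j < d) x (widen_ord (ltn_ord t) i) j.

Definition cstO {R : realType} {X : Type} (S : set X) (k : R) : X -> R :=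
  fun y => if `[< S y >] then k else 0.

Definition zeroPhi {R : realType} {T d : nat} : Phi R T d := fun t y => 0.
Definition addPhi {R : realType} {T d : nat} (p q : Phi R T d) : Phi R T d :=
  fun t y => p t y + q t y.
Definition scalePhi {R : realType} {T d : nat} (a : R) (p : Phi R T d) :
  Phi R T d := fun t y => a * p t y.
Definition oppPhi {R : realType} {T d : nat} (p : Phi R T d) : Phi R T d :=
  fun t y => - p t y.

Definition addcst {R : realType} {T d : nat} (K : 'I_T.+1 -> 'I_d -> set R)
    (p : Phi R T d) (beta : 'I_T.+1 -> R) : Phi R T d :=
  fun t => p t \+ cstO (Omt K t.+1) (beta t).

Definition inEall {R : realType} {T d : nat}
    (E : forall t : 'I_T.+1, set ('M[R]_(t.+1, d) -> R)) (p : Phi R T d) :=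
  forall t, E t (p t).

Definition good_E {R : realType} {T d : nat} (K : 'I_T.+1 -> 'I_d -> set R)
    (E : forall t : 'I_T.+1, set ('M[R]_(t.+1, d) -> R)) :=
  forall t : 'I_T.+1,
    E t `<=` Cw (Omt K t.+1) /\
    (forall k : R, E t (cstO (Omt K t.+1) k)) /\
    (forall p q, E t p -> E t q -> E t (p \+ q)) /\
    (forall (a : R) p, E t p -> E t (fun y => a * p y)).

Definition Vof {R : realType} {T d : nat} (U : Phi R T d -> \bar R)
    (p : Phi R T d) : \bar R := (- U (oppPhi p))%E.

Definition concave_U {R : realType} {T d : nat}
    (E : forall t : 'I_T.+1, set ('M[R]_(t.+1, d) -> R))
    (U : Phi R T d -> \bar R) :=
  (forall p, inEall E p -> U p != +oo%E) /\
  (forall p q (l : R), inEall E p -> inEall E q -> 0 < l < 1 ->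
     (l%:E * U p + (1 - l)%:E * U q <=
      U (addPhi (scalePhi l p) (scalePhi (1 - l)%R q)))%E).

Definition convex_cone {X : Type} {R : realType} (A : set (X -> R)) :=
  A (fun _ => 0) /\ (forall z1 z2, A z1 -> A z2 -> A (z1 \+ z2)) /\
  (forall (l : R) z, 0 <= l -> A z -> A (fun x => l * z x)).

Definition SU {R : realType} {T d : nat} (K : 'I_T.+1 -> 'I_d -> set R)
    (U : Phi R T d -> \bar R) (p : Phi R T d) : \bar R :=
  ereal_sup [set (U (addcst K p beta) - (\sum_(t < T.+1) beta t)%:E)%E
            | beta in [set: 'I_T.+1 -> R]].

Definition domSU {R : realType} {T d : nat} (K : 'I_T.+1 -> 'I_d -> set R)
    (E : forall t : 'I_T.+1, set ('M[R]_(t.+1, d) -> R))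
    (U : Phi R T d -> \bar R) : set (Phi R T d) :=
  [set p | inEall E p /\ (-oo < SU K U p)%E].

Definition Phiz {R : realType} {T d : nat} (K : 'I_T.+1 -> 'I_d -> set R)
    (E : forall t : 'I_T.+1, set ('M[R]_(t.+1, d) -> R))
    (U : Phi R T d -> \bar R) (z : 'M[R]_(T.+1, d) -> R)
    (c : 'M[R]_(T.+1, d) -> \bar R) : set (Phi R T d) :=
  [set p | domSU K E U p /\
     forall x, Om K x ->
       ((\sum_(t < T.+1) p t (projt t x) + z x)%:E <= c x)%E].

Definition Pfrak {R : realType} {T d : nat} (K : 'I_T.+1 -> 'I_d -> set R)
    (E : forall t : 'I_T.+1, set ('M[R]_(t.+1, d) -> R))
    (U : Phi R T d -> \bar R) (A : set ('M[R]_(T.+1, d) -> R))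
    (c : 'M[R]_(T.+1, d) -> \bar R) : \bar R :=
  ereal_sup [set SU K U p | p in
    [set p | exists2 a, A a & Phiz K E U (fun x => - a x) c p]].

Definition Prob1 {R : realType} {T d : nat} (K : 'I_T.+1 -> 'I_d -> set R)
    (Q : probability (Borel R T d) R) :=
  Q (Om K) = 1%E /\
  forall (i : 'I_T.+1) (j : 'I_d),
    (integral Q setT (fun x : 'M[R]_(T.+1, d) => (`|x i j|)%:E) < +oo)%E.

Definition polarA {R : realType} {T d : nat}
    (A : set ('M[R]_(T.+1, d) -> R)) (Q : probability (Borel R T d) R) :=
  forall z, A z -> (integral Q setT (fun x : 'M[R]_(T.+1, d) => (z x)%:E) <= 0)%E.

Definition EQ {R : realType} {T d : nat} (Q : probability (Borel R T d) R)
    (c : 'M[R]_(T.+1, d) -> \bar R) : \bar R := integral Q setT c.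

(* D(Q) = sup_{phi in E} ( U(phi) - sum_t int phi_t dQ_t ),
   with int_{Omega_{0:t}} phi_t dQ_t = E_Q[phi_t(x_0,...,x_t)] *)
Definition DQ {R : realType} {T d : nat}
    (E : forall t : 'I_T.+1, set ('M[R]_(t.+1, d) -> R))
    (U : Phi R T d -> \bar R) (Q : probability (Borel R T d) R) : \bar R :=
  ereal_sup [set (U p - \sum_(t < T.+1)
                   EQ Q (fun x => (p t (projt t x))%:E))%E | p in inEall E].

Definition lsc_on {R : realType} {m d : nat} (S : set 'M[R]_(m, d))
    (c : 'M[R]_(m, d) -> \bar R) :=
  forall x, S x -> forall a : R, (a%:E < c x)%E ->
    \forall y \near x, S y -> (a%:E < c y)%E.

(* Main.v *)
(* The functional h |-> P(c + h) on functions of linear growth is concave,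
   nondecreasing and cash additive, and finite as soon as P(c) < +oo: a value
   +oo at h would propagate to 0 by concavity, the value at -h being > -oo.
   Hahn-Banach gives a supergradient l at h = 0, a positive linear functional
   with l(1) = 1 and l <= 0 on A.  Testing it against -G f^n, condition (ii)
   makes l small on the functions f^n, i.e. uniformly outside compact sets, so
   by Dini's theorem l is sigma-continuous on continuous functions, and
   Daniell-Stone represents it by a probability Q.  Writing c as an increasing
   limit of continuous functions c_k of linear growth and testing l against
   the sums of phi in E minus c_k gives E_Q[c] + D(Q) <= P(c); the converse
   inequality holds for every Q.  Working directly at c, rather than
   at the c_k, avoids any compactness argument on the set of measures. *)

(* Infinite values, [+oo] for [c] and [-oo] for [U], obstruct convexity arguments. Statements on
   [Pfrak] are therefore read through [lt_Pfrak], which replaces the nested suprema by a real number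
   strictly below the value and by one triple: a [p] in [E], an [a] in [A] and a constant [b]
   collecting the cash shifts of [SU]. Hahn-Banach is proved for a convex majorant, because
   concavity of the functional gives no homogeneity. It is applied on all functions of linear
   growth, without continuity or measurability, so that the same estimates serve [Bw] in part (a)
   and the continuous functions in part (b). The functional [l] cannot be evaluated at [c], which
   may be infinite or grow too fast; it is tested on real minorants of [c], for one [p] at a time.
   The resulting bound is uniform over the approximants and passes to the integral. The choice
   [p = 0] makes [E_Q[c]] finite, and only then is the supremum defining [D(Q)] taken. *)
Require Import Defs.
From HB Require Import structures.
From mathcomp Require Import all_boot all_order all_algebra.
From mathcomp Require Import all_classical all_reals all_analysis.
From mathcomp Require Import measurable_realfun ring lra.
Import Order.TTheory GRing.Theory Num.Theory.
Import numFieldNormedType.Exports.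
Local Open Scope classical_set_scope.
Local Open Scope ring_scope.

(** * Hahn-Banach *)

(* Dominated partial linear functionals are handled through their graphs, so
   that Zorn's lemma for sets applies. *)
Definition dominated_graph {R : realType} {V : lmodType R} (D : set V)
    (p : V -> R) (G : set (V * R)) :=
  (forall a u v, G u -> G v -> G (a *: u.1 + v.1, a * u.2 + v.2)) /\
  (forall u, G u -> D u.1 /\ u.2 <= p u.1).

Section hahn_banach.
Context {R : realType} {V : lmodType R} (D : set V) (p : V -> R).
Hypothesis D0 : D 0.
Hypothesis Dlin : forall a x y, D x -> D y -> D (a *: x + y).
Hypothesis p_convex : forall x y l, D x -> D y -> 0 < l < 1 ->
  p (l *: x + (1 - l) *: y) <= l * p x + (1 - l) * p y.
Hypothesis p0 : 0 <= p 0.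

Lemma dominated_graph_bigcup (F : set (set (V * R))) :
  F `<=` dominated_graph D p -> total_on F subset ->
  dominated_graph D p (\bigcup_(X in F) X).
Proof.
move=> FG Ftot; split=> [a u v [X FX Xu] [Y FY Yv]|u [X FX Xu]].
  have [XY|YX] := Ftot _ _ FX FY.
  - by exists Y => //; apply: (FG _ FY).1 => //; exact: XY.
  - by exists X => //; apply: (FG _ FX).1 => //; exact: YX.
exact: (FG _ FX).2 Xu.
Qed.

Section extension.
Variables (G : set (V * R)) (h : V).
Hypothesis Gdom : dominated_graph D p G.
Hypothesis Dh : D h.
Hypothesis G00 : G (0, 0).

(** Convexity of [p] is used between [g1 - t *: h] and [g2 + s *: h] with weight [l = s / (s + t)],
    the one for which the multiples of [h] cancel, so that domination on [G] applies at the
    combination. Multiplying by [s + t] then separates the two slopes. *)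
Lemma dominated_graph_slopes g1 r1 g2 r2 s t :
  G (g1, r1) -> G (g2, r2) -> 0 < s -> 0 < t ->
  (r1 - p (g1 - t *: h)) / t <= (p (g2 + s *: h) - r2) / s.
Proof.
move=> G1 G2 s0 t0.
have [D1 _] := Gdom.2 _ G1; have [D2 _] := Gdom.2 _ G2; rewrite /= in D1 D2.
have st0 : 0 < s + t by rewrite addr_gt0.
pose l := s / (s + t).
have l1 : 1 - l = t / (s + t) by rewrite /l; field; rewrite gt_eqF.
have l01 : 0 < l < 1.
  by rewrite divr_gt0//= ltr_pdivrMr// mul1r ltrDl.
have Dm : D (g1 - t *: h) by rewrite -scaleNr addrC; apply: Dlin.
have Dp : D (g2 + s *: h) by rewrite addrC; apply: Dlin.
have := p_convex _ _ l Dm Dp l01.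
have -> : l *: (g1 - t *: h) + (1 - l) *: (g2 + s *: h) =
   l *: g1 + (1 - l) *: g2.
  rewrite l1 !scalerDr scalerN !scalerA addrACA.
  have -> : t / (s + t) * s = l * t by rewrite /l; ring.
  by rewrite addNr addr0.
have G3 : G ((1 - l) *: g2 + 0, (1 - l) * r2 + 0) by exact: (Gdom.1 _ (_, _) (_, _)).
have /Gdom.2[/= _] := Gdom.1 l _ _ G1 G3.
rewrite !addr0 => le1 le2.
have : l * r1 + (1 - l) * r2 <= l * p (g1 - t *: h) + (1 - l) * p (g2 + s *: h).
  exact: le_trans le1 le2.
rewrite l1 /l => H.
rewrite ler_pdivrMr// mulrAC ler_pdivlMr//.
have := H; rewrite -(ler_pM2l st0).
have E (a b : R) : (s + t) * (s / (s + t) * a + t / (s + t) * b) = s * a + t * b.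
  by field; rewrite gt_eqF.
by rewrite !E; nra.
Qed.

Lemma dominated_graph_extend :
  exists alpha, dominated_graph D p
    [set u | exists g r a, G (g, r) /\ u = (g + a *: h, r + a * alpha)].
Proof.
(* [L] collects the lower bounds that negative multiples of [h] impose on [alpha]. Positive
   multiples impose upper bounds, and [dominated_graph_slopes] places these above all of [L]. *)
pose L := [set (ur.1.2 - p (ur.1.1 - ur.2 *: h)) / ur.2
          | ur in [set ur : (V * R) * R | G ur.1 /\ 0 < ur.2]].
have Lub s g r : 0 < s -> G (g, r) -> ubound L ((p (g + s *: h) - r) / s).
  by move=> s0 Ggr _ [[[g' r'] t] [/= Gg' t0] <-]; exact: dominated_graph_slopes.
have L0 : L !=set0.
  by exists ((0 - p (0 - 1 *: h)) / 1); exists ((0, 0), 1) => //=; split.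
have supL : has_sup L.
  by split => //; exists ((p (0 + 1 *: h) - 0) / 1); exact: Lub.
exists (sup L); split.
  move=> a _ _ [g1 [r1 [a1 [G1 ->]]]] [g2 [r2 [a2 [G2 ->]]]] /=.
  exists (a *: g1 + g2), (a * r1 + r2), (a * a1 + a2); split.
    exact: (Gdom.1 _ (_, _) (_, _)).
  congr pair; last by ring.
  by rewrite scalerDr scalerA scalerDl addrACA.
move=> _ [g [r [a [Gg ->]]]] /=; have [Dg rp] := Gdom.2 _ Gg; rewrite /= in Dg rp.
split; first by rewrite addrC; exact: Dlin.
have [a0|a0|->] := ltgtP a 0; last by rewrite scale0r mul0r !addr0.
- have : (r - p (g - (- a) *: h)) / (- a) <= sup L.
    by apply: ub_le_sup; [exact: supL.2|exists ((g, r), - a) => //=; rewrite oppr_gt0].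
  rewrite ler_pdivrMr ?oppr_gt0// scaleNr opprK; lra.
- have : sup L <= (p (g + a *: h) - r) / a by apply: ge_sup => //; exact: Lub.
  by rewrite ler_pdivlMr//; lra.
Qed.

End extension.

Theorem hahn_banach_convex : exists l : V -> R,
  (forall a x y, D x -> D y -> l (a *: x + y) = a * l x + l y) /\
  (forall x, D x -> l x <= p x).
Proof.
have [G [Gdom Gmax]] := Zorn_bigcup dominated_graph_bigcup.
(* The empty graph is dominated as well, so a maximal one must be shown nonempty: otherwise [(0, 0)]
   alone would extend it, thanks to [0 <= p 0]. *)
have G00 : G (0, 0).
  have [//|nG] := pselect (G (0, 0)); exfalso.
  have G0 : G = set0.
    apply/seteqP; split=> // u Gu; apply: nG.
    by have := Gdom.1 (-1) _ _ Gu Gu; rewrite scaleN1r mulN1r !addNr.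
  apply: (Gmax [set (0, 0)]).
    by rewrite G0; split => // /(_ (0, 0)); apply.
  split=> [a _ _ -> ->|_ ->] //=; by rewrite scaler0 mulr0 !addr0.
have Gtot h : D h -> exists r, G (h, r).
  move=> Dh; have [alpha Gext] := dominated_graph_extend _ _ Gdom Dh G00.
  have [//|nG] := pselect (exists r, G (h, r)); exfalso; apply: Gmax Gext.
  split=> [[g r] Gg|sub]; first by exists g, r, 0; rewrite scale0r mul0r !addr0.
  apply: nG; exists alpha; apply: sub.
  by exists 0, 0, 1; rewrite scale1r mul1r !add0r.
(* A nonzero [r] could be rescaled to [p 0 + 1], against domination at 0. *)
have G0 r : G (0, r) -> r = 0.
  move=> G0r; apply/eqP/contraT => r0.
  have := Gdom.1 ((p 0 + 1) / r) _ _ G0r G00.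
  rewrite scaler0 /= !addr0 divfK// => /Gdom.2[_ /=].
  by rewrite -subr_ge0 opprD addNKr oppr_ge0 ler10.
have Gfun h r1 r2 : G (h, r1) -> G (h, r2) -> r1 = r2.
  move=> G1 G2; have := Gdom.1 (-1) _ _ G1 G2.
  by rewrite scaleN1r mulN1r /= addNr => /G0/eqP; rewrite addrC subr_eq0 => /eqP.
exists (fun h => xget 0 [set r | G (h, r)]).
have lG h : D h -> G (h, xget 0 [set r | G (h, r)]).
  by move=> /Gtot Gex; exact: (@xgetPex R 0 [set r | G (h, r)]).
split=> [a x y Dx Dy|x Dx]; last exact: (Gdom.2 _ (lG _ Dx)).2.
apply: (Gfun (a *: x + y)); first exact/lG/Dlin.
by apply: (Gdom.1 a (_, _) (_, _)); exact: lG.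
Qed.

End hahn_banach.

(** * The Daniell-Stone theorem *)

Section daniell.
Context {d : measure_display} {X : measurableType d} {R : realType}.
Variables (S : set X) (L : set (X -> R)) (I : (X -> R) -> R).
Hypothesis L1 : L (fun=> 1).
Hypothesis Llin : forall a f g, L f -> L g -> L (fun x => a * f x + g x).
Hypothesis Labs : forall f, L f -> L (fun x => `|f x|).
Hypothesis Ilin : forall a f g, L f -> L g ->
  I (fun x => a * f x + g x) = a * I f + I g.
Hypothesis Ipos : forall f, L f -> (forall x, S x -> 0 <= f x) -> 0 <= I f.
Hypothesis I1 : I (fun=> 1) = 1.
Hypothesis Icont : forall f_ : nat -> X -> R, (forall k, L (f_ k)) ->
  (forall k x, S x -> 0 <= f_ k.+1 x <= f_ k x) ->
  (forall x e, S x -> 0 < e -> exists k, f_ k x < e) ->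
  forall e, 0 < e -> exists k, I (f_ k) < e.

Let Lcst a : L (fun=> a).
Proof.
have := Llin (a - 1) _ _ L1 L1.
by congr L; apply/funext => x; ring.
Qed.

Let Icst a : I (fun=> a) = a.
Proof.
transitivity (I (fun x : X => (a - 1) * 1 + 1)).
  by congr I; apply/funext => x; ring.
by rewrite Ilin// I1; ring.
Qed.

Let LD f g : L f -> L g -> L (fun x => f x + g x).
Proof.
move=> Lf Lg; have := Llin 1 _ _ Lf Lg.
by congr L; apply/funext => x; rewrite mul1r.
Qed.

Let ID f g : L f -> L g -> I (fun x => f x + g x) = I f + I g.
Proof.
move=> Lf Lg; transitivity (I (fun x => 1 * f x + g x)).
  by congr I; apply/funext => x; rewrite mul1r.
by rewrite Ilin// mul1r.
Qed.

Let LZ a f : L f -> L (fun x => a * f x).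
Proof.
move=> Lf; have := Llin a _ _ Lf (Lcst 0).
by congr L; apply/funext => x; rewrite addr0.
Qed.

Let IZ a f : L f -> I (fun x => a * f x) = a * I f.
Proof.
move=> Lf; transitivity (I (fun x => a * f x + 0)).
  by congr I; apply/funext => x; rewrite addr0.
by rewrite Ilin// Icst addr0.
Qed.

Let LB f g : L f -> L g -> L (fun x => f x - g x).
Proof.
move=> Lf Lg; have := Llin (-1) _ _ Lg Lf.
by congr L; apply/funext => x; ring.
Qed.

Let IB f g : L f -> L g -> I (fun x => f x - g x) = I f - I g.
Proof.
move=> Lf Lg; transitivity (I (fun x => (-1) * g x + f x)).
  by congr I; apply/funext => x; ring.
by rewrite Ilin//; ring.
Qed.

Let Lmax f g : L f -> L g -> L (fun x => Num.max (f x) (g x)).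
Proof.
move=> Lf Lg.
have := LZ 2^-1 _ (LD _ _ (LD _ _ Lf Lg) (Labs _ (LB _ _ Lf Lg))).
by congr L; apply/funext => x; rewrite Num.Theory.maxr_absE mulrC.
Qed.

Let Lmin f g : L f -> L g -> L (fun x => Num.min (f x) (g x)).
Proof.
move=> Lf Lg.
have := LZ 2^-1 _ (LB _ _ (LD _ _ Lf Lg) (Labs _ (LB _ _ Lf Lg))).
by congr L; apply/funext => x; rewrite Num.Theory.minr_absE mulrC.
Qed.

Let Imono f g : L f -> L g -> (forall x, S x -> f x <= g x) -> I f <= I g.
Proof.
move=> Lf Lg fg; rewrite -subr_ge0 -IB//; apply: Ipos; first exact: LB.
by move=> x Sx; rewrite subr_ge0 fg.
Qed.

Let Lsum n (h : nat -> X -> R) : (forall i, L (h i)) ->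
  L (fun x => \sum_(i < n) h i x).
Proof.
move=> Lh; elim: n => [|n IHn].
  by have := Lcst 0; congr L; apply/funext => x; rewrite big_ord0.
by have := LD _ _ IHn (Lh n); congr L; apply/funext => x; rewrite big_ord_recr.
Qed.

Let Isum n (h : nat -> X -> R) : (forall i, L (h i)) ->
  I (fun x => \sum_(i < n) h i x) = \sum_(i < n) I (h i).
Proof.
move=> Lh; elim: n => [|n IHn].
  rewrite big_ord0 -[RHS](Icst 0).
  by congr I; apply/funext => x; rewrite big_ord0.
rewrite big_ord_recr /= -IHn -ID//; last exact: Lsum.
by congr I; apply/funext => x; rewrite big_ord_recr.
Qed.

(** Covers see [A] only inside [S], so the zero sequence covers the complement of [S], which gets
    measure zero. The value 1 is reached at a finite index, so that for [f <= 1] the difference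
    [f - g k] becomes nonpositive on [A] after finitely many steps. *)
Definition daniell_cover (A : set X) (g : nat -> X -> R) : Prop :=
  [/\ forall k, L (g k),
      forall k x, S x -> 0 <= g k x <= g k.+1 x &
      forall x, S x -> A x -> exists k, 1 <= g k x].

Definition daniell_lim (g : nat -> X -> R) : \bar R :=
  ereal_sup [set (I (g k))%:E | k in [set: nat]].

(** The Daniell upper integral of the indicator of [A]. *)
Definition daniell_outer (A : set X) : \bar R :=
  ereal_inf [set daniell_lim g | g in daniell_cover A].

Local Notation mu := daniell_outer.

Let lim_ub g k : ((I (g k))%:E <= daniell_lim g)%E.
Proof. by apply: ereal_sup_ubound; exists k. Qed.

Let cover_homo A g : daniell_cover A g ->
  forall x, S x -> {homo g^~ x : m n / (m <= n)%N >-> m <= n}.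
Proof.
move=> [_ gmon _] x Sx; apply: homo_leq => //; first exact: le_trans.
by move=> k; have /andP[] := gmon k x Sx.
Qed.

Let lim_ge0 A g : daniell_cover A g -> (0 <= daniell_lim g)%E.
Proof.
move=> [Lg gmon _]; apply: le_trans (lim_ub _ 0); rewrite lee_fin.
by apply: Ipos => // x Sx; have /andP[] := gmon 0%N x Sx.
Qed.

Let mu_ge0 A : (0 <= mu A)%E.
Proof. by apply: le_ereal_inf_tmp => _ [g /lim_ge0 + <-]. Qed.

Let mu_le_I A f : L f -> (forall x, S x -> 0 <= f x) ->
  (forall x, S x -> A x -> 1 <= f x) -> (mu A <= (I f)%:E)%E.
Proof.
move=> Lf f0 f1; apply: ge_ereal_inf; exists (daniell_lim (fun=> f)).
  exists (fun=> f) => //; split => //; last by move=> x Sx Ax; exists 0%N; exact: f1.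
  by move=> _ x Sx; rewrite lexx f0.
by apply: ge_ereal_sup => _ [k _ <-].
Qed.

(** Continuity of [I] along decreasing sequences enters here: for a cover [g] of [A], the positive
    parts of [f - g k] decrease to 0 on [S], because [g k] reaches 1 on [A] and [f <= 0 <= g k]
    elsewhere. *)
Let I_le_mu A f : L f -> (forall x, S x -> f x <= 1) ->
  (forall x, S x -> ~ A x -> f x <= 0) -> ((I f)%:E <= mu A)%E.
Proof.
move=> Lf f1 f0; apply: le_ereal_inf_tmp => _ [g cg <-].
have ghomo := cover_homo _ _ cg; case: cg => Lg gmon gA.
apply/lee_addgt0Pr => e e0.
have [|||k Ik] := Icont (fun k x => Num.max (f x - g k x) 0) _ _ _ e e0.
- by move=> k; apply: (Lmax _ _ (LB _ _ Lf (Lg k)) (Lcst 0)).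
- move=> k x Sx; rewrite le_max lexx orbT /=.
  have /andP[_ gk] := gmon k x Sx.
  by rewrite ge_max !le_max lexx orbT andbT lerD2l lerN2 gk.
- move=> x r Sx r0; have [Ax|nAx] := pselect (A x).
    have [k gk] := gA _ Sx Ax; exists k; rewrite gt_max r0 andbT.
    by have := f1 _ Sx; lra.
  exists 0%N; rewrite gt_max r0 andbT.
  by have := f0 _ Sx nAx; have /andP[] := gmon 0%N x Sx; lra.
apply: (@le_trans _ _ (I (g k) + e)%:E); last first.
  by rewrite EFinD leeD2r.
rewrite lee_fin -lerBlDl -IB//; apply: le_trans (ltW Ik); apply: Imono.
- exact: LB.
- by apply: (Lmax _ _ (LB _ _ Lf (Lg k)) (Lcst 0)).
- by move=> x Sx; rewrite le_max lexx.
Qed.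

Let mu_le1 A : (mu A <= 1)%E.
Proof. by have := mu_le_I A _ L1; rewrite I1; apply. Qed.

Let mu_fin A : mu A \is a fin_num.
Proof.
rewrite ge0_fin_numE//; apply: le_lt_trans (mu_le1 A) _; exact: ltry.
Qed.

Let mu_setT : mu setT = 1%E.
Proof.
apply/eqP; rewrite eq_le mu_le1 /=.
by have := I_le_mu setT _ L1; rewrite I1; apply => // x _ [].
Qed.

Let mu_setC : mu (~` S) = 0%E.
Proof.
apply/eqP; rewrite eq_le mu_ge0 andbT.
by have := mu_le_I (~` S) _ (Lcst 0); rewrite Icst; apply.
Qed.

Let mu_homo : {homo mu : A B / A `<=` B >-> (A <= B)%E}.
Proof.
move=> A B AB; apply: ereal_inf_le_tmp => _ [g [Lg gmon gB] <-].
by exists g => //; split => // x Sx /AB; exact: gB.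
Qed.

Let mu0 : mu set0 = 0%E.
Proof.
apply/eqP; rewrite eq_le mu_ge0 andbT.
by have := mu_le_I set0 _ (Lcst 0); rewrite Icst; apply.
Qed.

Let mu_subadd : sigma_subadditive mu.
Proof.
move=> F; apply/lee_addgt0Pr => e e0.
apply: le_trans (epsilon_trick _ _ (ltW e0)) => //.
have /choice[g cg] i : exists g, daniell_cover (F i) g /\
    (daniell_lim g <= mu (F i) + (e / (2 ^ i.+1)%:R)%:E)%E.
  have e20 : 0 < e / (2 ^ i.+1)%:R by rewrite divr_gt0// ltr0n expn_gt0.
  have [_ [g cg <-] /ltW lg] := lb_ereal_inf_adherent e20 (mu_fin (F i)).
  by exists g.
(* Diagonal sums: finitely many covers occur at each stage, so [G k] stays in [L], and it reaches 1
   on [F i] once [k] exceeds both [i] and the index at which [g i] does. *)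
pose G k x := \sum_(i < k) g i k x.
have LG k : L (G k) by apply: (Lsum k (fun i => g i k)) => i; case: (cg i) => -[].
apply: ge_ereal_inf; exists (daniell_lim G).
  exists G => //; split=> //.
  - move=> k x Sx; apply/andP; split.
      apply: sumr_ge0 => i _; case: (cg i) => -[_ gmon _] _.
      by have /andP[] := gmon k x Sx.
    rewrite /G big_ord_recr /= -[leLHS]addr0 lerD//.
      apply: ler_sum => i _; case: (cg i) => -[_ gmon _] _.
      by have /andP[] := gmon k x Sx.
    by case: (cg k) => -[_ gmon _] _; have /andP[] := gmon k.+1 x Sx.
  - move=> x Sx [i _ Fix].
    case: (cg i) => cgi _; have ghomo := cover_homo _ _ cgi x Sx.
    case: cgi => Lg gmon /(_ x Sx Fix)[k gk].
    pose m := maxn i.+1 k; exists m.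
    have im : (i < m)%N by rewrite leq_max leqnn.
    rewrite /G (bigD1 (Ordinal im))//= -[leLHS]addr0 lerD//.
      apply: le_trans gk _; apply: ghomo; exact: leq_maxr.
    apply: sumr_ge0 => j _; case: (cg j) => -[_ gjmon _] _.
    by have /andP[] := gjmon m x Sx.
apply: ge_ereal_sup => _ [k _ <-].
rewrite /G (Isum k (fun i => g i k)); last by move=> i; case: (cg i) => -[].
apply: le_trans (nneseries_lim_ge k _); last first.
  by move=> i _ _; apply: adde_ge0 => //; rewrite lee_fin divr_ge0// ltW.
rewrite big_mkord -sumEFin; apply: lee_sum => i _.
by apply: le_trans (cg i).2; exact: lim_ub.
Qed.

(** The functions [h j], the minimum of 1 and [j] times the positive part of [f], increase to the
    indicator of [P]. If [g] covers [A], then [min (g k) (h k)] covers [A] inside [P], and for each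
    [j] the sequence [g k - min (g k) (h j)] covers [A] outside [P]. There [j] is frozen, since the
    positive part of [g k - h j] increases with [k] but decreases with [j]. Additivity of [I] bounds
    the two limits together by that of [g]. *)
Let gt0_caratheodory f : L f -> mu.-caratheodory [set x | 0 < f x].
Proof.
move=> Lf.
pose o : {outer_measure set X -> \bar R} :=
  HB.pack mu (isOuterMeasure.Build R X mu mu0 mu_ge0 mu_homo mu_subadd).
apply: (@le_caratheodory_measurable R X o) => A /=.
set P := [set x | 0 < f x].
apply: le_ereal_inf_tmp => _ [g cg <-].
have ghomo := cover_homo _ _ cg; case: cg => Lg gmon gA.
pose h j x := Num.min 1 (j%:R * Num.max (f x) 0).
have Lh j : L (h j) := Lmin _ _ L1 (LZ j%:R _ (Lmax _ _ Lf (Lcst 0))).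
have fp x : 0 <= Num.max (f x) 0 by rewrite le_max lexx orbT.
have h0 j x : 0 <= h j x by rewrite /h le_min ler01 mulr_ge0.
have hmon j k x : (j <= k)%N -> h j x <= h k x.
  move=> jk; rewrite /h le_min ge_min lexx /= ge_min; apply/orP; right.
  by apply: ler_wpM2r => //; rewrite ler_nat.
have hN j x : ~ P x -> h j x = 0.
  move=> nPx; rewrite /h max_r ?mulr0 ?min_r//.
  by rewrite leNgt; apply/negP.
have hP x : P x -> exists m, 1 <= h m x.
  move=> Px; exists (Num.trunc (f x)^-1).+1; rewrite /h le_min lexx /=.
  rewrite max_l; last exact: ltW.
  by rewrite -ler_pdivrMr// mul1r; apply/ltW/truncnS_gt.
clearbody h.
have Lgh k j : L (fun x => Num.min (g k x) (h j x)) by exact: Lmin.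
have g0 k x : S x -> 0 <= g k x by move=> Sx; have /andP[] := gmon k x Sx.
have le1 : (mu (A `&` P) <= daniell_lim (fun k x => Num.min (g k x) (h k x)))%E.
  apply: ereal_inf_lbound; exists (fun k x => Num.min (g k x) (h k x)) => //.
  split => // [k x Sx|x Sx [Ax Px]].
    rewrite le_min g0// h0 /=; have /andP[_ gk] := gmon k x Sx.
    by rewrite le_min !ge_min gk hmon ?orbT.
  have [k gk] := gA x Sx Ax.
  have [m hm] := hP x Px.
  exists (maxn k m); rewrite le_min (le_trans gk) ?ghomo ?leq_maxl//=.
  by rewrite (le_trans hm)// hmon// leq_maxr.
have le2 j : (mu (A `&` ~` P) <=
    daniell_lim g - (I (fun x => Num.min (g j x) (h j x)))%:E)%E.
  apply: (@le_trans _ _ (daniell_lim (fun k x => g k x - Num.min (g k x) (h j x)))).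
    apply: ereal_inf_lbound; exists (fun k x => g k x - Num.min (g k x) (h j x)) => //.
    split=> [k|k x Sx|x Sx [Ax nPx]]; first exact: LB.
      rewrite subr_ge0 ge_min lexx /=; have /andP[_ gk] := gmon k x Sx.
      by rewrite /Num.min; case: ifPn; case: ifPn; rewrite -?leNgt; lra.
    have [k gk] := gA x Sx Ax; exists k.
    by rewrite hN// min_r ?subr0// g0.
  apply: ge_ereal_sup => _ [k _ <-].
  rewrite leeBrDr// -EFinD IB// -addrA.
  apply: le_trans (lim_ub _ (maxn j k)); rewrite lee_fin.
  set m := maxn j k.
  apply: (@le_trans _ _ (I (g m) - I (fun x => Num.min (g m x) (h j x)) +
     I (fun x => Num.min (g m x) (h j x)))); last by rewrite subrK.
  rewrite addrA lerD//; last first.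
    apply: Imono => // x Sx; rewrite le_min !ge_min lexx orbT andbT.
    by rewrite ghomo// leq_maxl.
  rewrite -!IB//; apply: Imono; [exact: LB|exact: LB|move=> x Sx].
  have gkm : g k x <= g m x by apply: ghomo => //; exact: leq_maxr.
  by rewrite /Num.min; case: ifPn; case: ifPn; rewrite -?leNgt; lra.
have Afin := mu_fin (A `&` ~` P).
rewrite -leeBrDr//; apply: (le_trans le1).
apply: ge_ereal_sup => _ [k _ <-].
by rewrite leeBrDl// -leeBrDr//; exact: le2.
Qed.

Hypothesis mS : measurable S.
Hypothesis Lmeas : forall f, L f -> measurable_fun S f.
Hypothesis Lgen : forall A : set X, measurable A ->
  <<s [set [set x | 0 < f x] | f in L] >> A.

Let measurable_caratheodory (A : set X) : measurable A -> mu.-caratheodory A.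
Proof.
move=> /Lgen; apply; split; last by move=> _ [f Lf <-]; exact: gt0_caratheodory.
pose o : {outer_measure set X -> \bar R} :=
  HB.pack mu (isOuterMeasure.Build R X mu mu0 mu_ge0 mu_homo mu_subadd).
split => [|B mB|F mF].
- exact: (@caratheodory_measurable_set0 R X o).
- rewrite setTD; exact: (@caratheodory_measurable_setC R X o).
- exact: (@caratheodory_measurable_bigcup R X o).
Qed.

Let mu_sigma_additive : semi_sigma_additive (mu : set X -> _).
Proof.
pose o : {outer_measure set X -> \bar R} :=
  HB.pack mu (isOuterMeasure.Build R X mu mu0 mu_ge0 mu_homo mu_subadd).
move=> F mF tF mUF.
apply: (@caratheodory_measure_sigma_additive R X o) => //.
- by move=> i; exact: measurable_caratheodory.
- exact: measurable_caratheodory.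
Qed.

Lemma daniell_probability : exists Q : probability X R,
  forall A, Q A = mu A.
Proof.
pose m : {measure set X -> \bar R} :=
  HB.pack mu (isMeasure.Build d X R mu mu0 mu_ge0 mu_sigma_additive).
pose Q : probability X R :=
  HB.pack (Measure.sort m) (Measure.class m)
    (Measure_isProbability.Build d X R m mu_setT).
by exists Q.
Qed.

Section integral.
Variables (Q : probability X R) (f : X -> R).
Hypothesis QE : forall A, Q A = mu A.
Hypothesis Lf : L f.
Hypothesis f_ge0 : forall x, S x -> 0 <= f x.

Local Notation J g := (\int[Q]_(x in S) (g x)%:E)%E.

(** The slice of [f] between the heights [t] and [t + delta]. On [S] it lies between [delta] times
    the indicators of [f > t + delta] and of [f > t], so [I] and the integral of a slice obey the
    same two bounds. *)
Let layer delta t x : R := Num.min (f x) (t + delta) - Num.min (f x) t.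

Let Llayer delta t : L (layer delta t).
Proof. exact: (LB _ _ (Lmin _ _ Lf (Lcst (t + delta))) (Lmin _ _ Lf (Lcst t))). Qed.

Let layer_ge0 delta t x : 0 < delta -> 0 <= layer delta t x.
Proof.
move=> d0; rewrite subr_ge0 le_min !ge_min lexx /=.
by rewrite lerDl (ltW d0) orbT.
Qed.

Let layer_le delta t x : 0 < delta -> layer delta t x <= delta.
Proof.
by move=> d0; rewrite /layer /Num.min; case: ifPn; case: ifPn;
  rewrite -?leNgt; lra.
Qed.

Let layer_0 delta t x : 0 < delta -> f x <= t -> layer delta t x = 0.
Proof.
move=> d0 ft; rewrite /layer !min_l ?subrr//.
by rewrite (le_trans ft)// lerDl ltW.
Qed.

Let layer_delta delta t x : 0 < delta -> t + delta < f x ->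
  layer delta t x = delta.
Proof.
move=> d0 tf; rewrite /layer !min_r; [by ring| |exact: ltW].
by rewrite (le_trans _ (ltW tf))// lerDl ltW.
Qed.

Let above t : set X := S `&` [set x | t < f x].

Let mabove t : measurable (above t).
Proof.
rewrite (_ : above t = S `&` f @^-1` `]t, +oo[%classic); first exact: Lmeas.
by apply/seteqP; split=> x [Sx /=]; rewrite in_itv/= andbT; split.
Qed.

Let I_layer_le delta t : 0 < delta ->
  ((I (layer delta t))%:E <= delta%:E * Q (above t))%E.
Proof.
move=> d0; rewrite -lee_pdivrMl// QE -EFinM -IZ//; apply: I_le_mu.
- exact: LZ.
- by move=> x Sx; rewrite ler_pdivrMl// mulr1 layer_le.
- move=> x Sx /not_andP[//|/negP]; rewrite -leNgt => fxt.
  by rewrite layer_0// mulr0.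
Qed.

Let I_layer_ge delta t : 0 < delta ->
  (delta%:E * Q (above (t + delta)%R) <= (I (layer delta t))%:E)%E.
Proof.
move=> d0; rewrite -lee_pdivlMl// QE -EFinM -IZ//; apply: mu_le_I.
- exact: LZ.
- by move=> x Sx; rewrite mulr_ge0 ?invr_ge0 ?layer_ge0// ltW.
- by move=> x Sx [_ /= fxt]; rewrite layer_delta// mulVf// gt_eqF.
Qed.

Let EFin_meas g : L g -> measurable_fun S (fun x => (g x)%:E : \bar R).
Proof. by move=> Lg; apply/measurable_EFinP; exact: Lmeas. Qed.

Let J_above delta t : 0 < delta ->
  (\int[Q]_(x in S) (delta * \1_(above t) x)%:E = delta%:E * Q (above t))%E.
Proof.
move=> d0; under eq_integral do rewrite EFinM.
rewrite ge0_integralZl_EFin//; last exact: ltW.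
  2: by apply/measurable_EFinP; exact: measurable_indic.
rewrite integral_indic// setIidl//.
by move=> x [].
Qed.

Let meas_above delta t :
  measurable_fun S (fun x => (delta * \1_(above t) x)%:E : \bar R).
Proof.
by apply/measurable_EFinP; apply: measurable_funM.
Qed.

Let J_layer_le delta t : 0 < delta ->
  (J (layer delta t) <= delta%:E * Q (above t))%E.
Proof.
move=> d0; rewrite -J_above//; apply: ge0_le_integral => //.
- by move=> x _; rewrite lee_fin layer_ge0.
- exact: EFin_meas.
- move=> x Sx; rewrite lee_fin indicE; case: (boolP (x \in above t)).
    by rewrite mulr1 layer_le.
  move=> /negP; rewrite inE => /not_andP[//|/negP]; rewrite -leNgt => fxt.
  by rewrite mulr0 layer_0.
Qed.

Let J_layer_ge delta t : 0 < delta ->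
  (delta%:E * Q (above (t + delta)%R) <= J (layer delta t))%E.
Proof.
move=> d0; rewrite -J_above//; apply: ge0_le_integral => //.
- by move=> x _; rewrite lee_fin mulr_ge0// ltW.
- exact: EFin_meas.
- move=> x Sx; rewrite lee_fin indicE; case: (boolP (x \in above _)).
    by rewrite inE => -[_ fxt]; rewrite mulr1 layer_delta.
  by rewrite mulr0 layer_ge0.
Qed.

Let trunc (delta : R) (m : nat) x : R := Num.min (f x) (m%:R * delta).

Let Ltrunc delta m : L (trunc delta m).
Proof. exact: (Lmin _ _ Lf (Lcst (m%:R * delta))). Qed.

Let trunc_ge0 delta m x : 0 < delta -> S x -> 0 <= trunc delta m x.
Proof. by move=> d0 Sx; rewrite le_min f_ge0//= mulr_ge0// ltW. Qed.

Let truncS delta m :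
  trunc delta m.+1 = fun x => trunc delta m x + layer delta (m%:R * delta) x.
Proof.
apply/funext => x; rewrite /trunc /layer addrC subrK.
by congr Num.min; rewrite -natr1; ring.
Qed.

Let J_truncS delta m : 0 < delta ->
  (J (trunc delta m.+1) = J (trunc delta m) + J (layer delta (m%:R * delta)))%E.
Proof.
move=> d0; rewrite truncS; under eq_integral do rewrite EFinD.
rewrite ge0_integralD//.
- by move=> x Sx; rewrite lee_fin trunc_ge0.
- exact: EFin_meas.
- by move=> x Sx; rewrite lee_fin layer_ge0.
- exact: EFin_meas.
Qed.

(** The upper bound for [I] on a slice is the lower bound for the integral on the slice below.
    Summing therefore compares the two with a shift by one slice, and the unmatched lowest slice
    costs at most [delta]. *)
Let I_trunc_le delta m : 0 < delta ->
  ((I (trunc delta m.+1))%:E <= delta%:E + J (trunc delta m))%E.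
Proof.
move=> d0; elim: m => [|m IHm].
  apply: (@le_trans _ _ delta%:E); last first.
    apply: leeDl; apply: integral_ge0 => x Sx.
    by rewrite lee_fin trunc_ge0.
  rewrite lee_fin -[leRHS]Icst; apply: Imono => // x Sx.
  by rewrite ge_min mul1r lexx orbT.
rewrite truncS ID// EFinD J_truncS// addeA; apply: leeD => //.
apply: le_trans (I_layer_le _ _ d0) _.
rewrite (_ : m.+1%:R * delta = m%:R * delta + delta); first exact: J_layer_ge.
by rewrite -natr1; ring.
Qed.

Let J_trunc_le delta m : 0 < delta ->
  (J (trunc delta m.+1) <= delta%:E + (I (trunc delta m))%:E)%E.
Proof.
move=> d0; elim: m => [|m IHm].
  apply: (@le_trans _ _ delta%:E); last first.
    apply: leeDl; rewrite lee_fin; apply: Ipos => // x Sx.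
    exact: trunc_ge0.
  apply: (@le_trans _ _ (\int[Q]_(x in S) (cst delta%:E x))%E).
    apply: ge0_le_integral => //.
    - by move=> x Sx; rewrite lee_fin trunc_ge0.
    - exact: EFin_meas.
    - by move=> x Sx; rewrite lee_fin ge_min mul1r lexx orbT.
  rewrite integral_cst// -[leRHS]mule1; apply: lee_wpmul2l.
    by rewrite lee_fin ltW.
  by have := mu_le1 S; rewrite -QE.
rewrite J_truncS//.
have -> : I (trunc delta m.+1) =
    I (trunc delta m) + I (layer delta (m%:R * delta)) by rewrite truncS ID.
rewrite (_ : (_ + _)%:E = (I (trunc delta m))%:E +
  (I (layer delta (m%:R * delta)))%:E)%E// [leRHS]addeA; apply: leeD => //.
rewrite (_ : m.+1%:R * delta = m%:R * delta + delta); last first.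
  by rewrite -natr1; ring.
by apply: le_trans (J_layer_le _ _ d0) _; exact: I_layer_ge.
Qed.

Let trunc_homo delta m x : 0 < delta -> trunc delta m x <= trunc delta m.+1 x.
Proof. by move=> d0; rewrite truncS lerDl layer_ge0. Qed.

Let trunc_eventually delta x : 0 < delta ->
  exists m, forall n, (m <= n)%N -> trunc delta n x = f x.
Proof.
move=> d0; exists (Num.trunc (f x / delta)).+1 => n mn; rewrite /trunc min_l//.
rewrite -ler_pdivrMr//; apply: le_trans (ltW (truncnS_gt _)) _.
by rewrite ler_nat.
Qed.

Let I_le_J : ((I f)%:E <= J f)%E.
Proof.
apply/lee_addgt0Pr => e e0.
(* One [delta] pays for truncating [f], the other for the shift of slices in [I_trunc_le]. *)
pose delta := e / 2; have d0 : 0 < delta by rewrite divr_gt0.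
have [|||k] := Icont (fun k x => f x - trunc delta k x) _ _ _ delta d0.
- by move=> k; exact: LB.
- move=> k x Sx; rewrite subr_ge0 ge_min lexx /=.
  by rewrite lerD2l lerN2 trunc_homo.
- move=> x r Sx r0; have [m mP] := trunc_eventually delta x d0.
  by exists m; rewrite mP// subrr.
rewrite IB// ltrBlDr => Ifk.
apply: (@le_trans _ _ (delta%:E + (delta%:E + J (trunc delta k))%E)%E).
  apply: (@le_trans _ _ (delta%:E + (I (trunc delta k.+1))%:E)%E).
    rewrite -EFinD lee_fin (le_trans (ltW Ifk))// lerD2l.
    by apply: Imono => // x Sx; exact: trunc_homo.
  by apply: leeD => //; exact: I_trunc_le.
rewrite addeA -EFinD (_ : delta + delta = e); last by rewrite /delta; field.
rewrite addeC leeD2r//; apply: ge0_le_integral => //.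
- by move=> x Sx; rewrite lee_fin trunc_ge0.
- exact: EFin_meas.
- exact: EFin_meas.
- by move=> x Sx; rewrite lee_fin ge_min lexx.
Qed.

Let J_le_I : (J f <= (I f)%:E)%E.
Proof.
apply/lee_addgt0Pr => e e0.
have -> : J f = (\int[Q]_(x in S) limn (fun m => (trunc e m x)%:E))%E.
  apply: eq_integral => x _; apply/esym/cvg_lim => //.
  have [m mP] := trunc_eventually e x e0.
  apply: (@cvg_trans _ ((fun=> (f x)%:E) @ \oo)); last exact: cvg_cst.
  apply: near_eq_cvg; near=> n; rewrite mP//.
  by near: n; exists m.
rewrite monotone_convergence//; last 3 first.
- by move=> n; exact: EFin_meas.
- by move=> n x Sx; rewrite lee_fin trunc_ge0.
- move=> x Sx; apply: homo_leq => //; first exact: le_trans.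
  by move=> n; rewrite lee_fin trunc_homo.
have Jle m : (J (trunc e m) <= (I f)%:E + e%:E)%E.
  apply: (@le_trans _ _ (J (trunc e m.+1))).
    apply: ge0_le_integral => //.
    - by move=> x Sx; rewrite lee_fin trunc_ge0.
    - exact: EFin_meas.
    - exact: EFin_meas.
    - by move=> x Sx; rewrite lee_fin trunc_homo.
  apply: (le_trans (J_trunc_le _ _ e0)); rewrite addeC leeD2r// lee_fin.
  by apply: Imono => // x Sx; rewrite ge_min lexx.
apply: lime_le; last by apply: nearW.
apply: ereal_nondecreasing_is_cvgn; apply: homo_leq => //; first exact: le_trans.
move=> n; apply: ge0_le_integral => //.
- by move=> x Sx; rewrite lee_fin trunc_ge0.
- exact: EFin_meas.
- exact: EFin_meas.
- by move=> x Sx; rewrite lee_fin trunc_homo.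
Unshelve. all: by end_near. Qed.

Lemma daniell_integral_ge0 : J f = (I f)%:E.
Proof. by apply/eqP; rewrite eq_le J_le_I I_le_J. Qed.

End integral.

Theorem daniell_stone : exists Q : probability X R, Q S = 1%E /\
  forall f, L f -> Q.-integrable S (EFin \o f) /\
    (\int[Q]_(x in S) (f x)%:E = (I f)%:E)%E.
Proof.
have [Q QE] := daniell_probability; exists Q; split.
  by rewrite -[S]setCK probability_setC ?QE ?mu_setC ?sube0//; exact: measurableC.
have Labsf f : L f -> (\int[Q]_(x in S) (`|f x|)%:E = (I (fun x => `|f x|))%:E)%E.
  by move=> Lf; apply: daniell_integral_ge0 => //; exact: Labs.
have Lint f : L f -> Q.-integrable S (EFin \o f).
  move=> Lf; apply/integrableP; split; first by apply/measurable_EFinP; exact: Lmeas.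
  by rewrite (eq_integral (fun x => (`|f x|)%:E))// Labsf// ltry.
move=> f Lf; split; first exact: Lint.
(* [f] is the difference of [|f| + f] and [|f|], which are nonnegative and in [L]. *)
have Lf' := LD _ _ (Labs _ Lf) Lf.
transitivity (\int[Q]_(x in S) ((`|f x| + f x)%:E - (`|f x|)%:E))%E.
  by apply: eq_integral => x _; rewrite -EFinB; congr EFin; ring.
rewrite integralB_EFin//; [|exact: Lint|by apply: Lint; exact: Labs].
rewrite Labsf// (daniell_integral_ge0 Q (fun x => `|f x| + f x))//.
  by rewrite ID// ?EFinD; [rewrite addeAC subee ?add0e|exact: Labs].
move=> x _; have := ler_norm (- f x); rewrite normrN; lra.
Qed.
End daniell.

(** * Lipschitz functions increasing to a lower semicontinuous one *)

Lemma lipschitz_continuous {R : realType} {X : normedModType R} (k : R)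
    (f : X -> R) : 0 <= k -> (forall x y, f x <= f y + k * `|x - y|) ->
  continuous f.
Proof.
move=> k0 fk x; apply/cvgrPdist_lt => e e0.
have k1 : 0 < k + 1 by lra.
near=> y.
have xy : `|x - y| < e / (k + 1).
  have : ball x (e / (k + 1)) y.
    by near: y; apply: nbhsx_ballx; rewrite divr_gt0.
  by rewrite -ball_normE.
have le1 := fk x y; have le2 := fk y x; rewrite (distrC y x) in le2.
move: xy; rewrite ltr_pdivlMr// => xy.
have := normr_ge0 (x - y) => n0.
rewrite ltr_norml; nra.
Unshelve. all: by end_near. Qed.

(* The approximants are the inf-convolutions of [min(g, k)] with [k * norm]. *)
Lemma lsc_approx {R : realType} {X : normedModType R} (g : X -> \bar R) :
  (forall x, (0 <= g x)%E) ->
  (forall x a, (a%:E < g x)%E -> \forall y \near x, (a%:E < g y)%E) ->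
  exists h : nat -> X -> R, [/\ forall k, continuous (h k),
    forall k x, 0 <= h k x <= h k.+1 x, forall k x, h k x <= k%:R,
    forall k x, ((h k x)%:E <= g x)%E &
    forall x a, (a%:E < g x)%E -> exists k, a <= h k x].
Proof.
move=> g0 lscg.
pose m (k : nat) y : R := fine (mine (g y) k%:R%:E).
have mE k y : (m k y)%:E = mine (g y) k%:R%:E.
  rewrite fineK// ge0_fin_numE ?gt_min ?ltry ?orbT//.
  by rewrite le_min g0 lee_fin ler0n.
have m0 k y : 0 <= m k y by rewrite -lee_fin mE le_min g0 lee_fin ler0n.
have mk k y : m k y <= k%:R by rewrite -lee_fin mE ge_min lexx orbT.
have mg k y : ((m k y)%:E <= g y)%E by rewrite mE ge_min lexx.
have mS k y : m k y <= m k.+1 y.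
  rewrite -lee_fin !mE le_min !ge_min lexx /= lee_fin ler_nat leqnSn.
  by rewrite orbT.
pose A k x := [set m k y + k%:R * `|x - y| | y in [set: X]].
have A0 k x : A k x !=set0 by exists (m k x + k%:R * `|x - x|); exists x.
have Alb k x : has_lbound (A k x).
  by exists 0 => _ [y _ <-]; rewrite addr_ge0// mulr_ge0// ler0n.
pose h k x := inf (A k x).
have hle k x y : h k x <= m k y + k%:R * `|x - y|.
  by apply: ge_inf => //; exists y.
have hm k x : h k x <= m k x.
  by have := hle k x x; rewrite subrr normr0 mulr0 addr0.
exists h; split.
- move=> k; apply: (@lipschitz_continuous _ _ k%:R) => // x y.
  rewrite -lerBlDr; apply: lb_le_inf => // _ [z _ <-].
  rewrite lerBlDr; apply: le_trans (hle k x z) _.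
  rewrite -addrA lerD2l -mulrDr ler_wpM2l// [leRHS]addrC.
  exact: ler_distD.
- move=> k x; apply/andP; split; apply: lb_le_inf => // _ [y _ <-].
    by rewrite addr_ge0// mulr_ge0.
  apply: le_trans (hle k x y) _; rewrite lerD//.
  by rewrite ler_wpM2r// ler_nat.
- by move=> k x; apply: le_trans (hm k x) _.
- by move=> k x; apply: le_trans (mg k x); rewrite lee_fin.
- move=> x a ax; have [a0|a0] := ltP a 0.
    exists 0%N; apply: (le_trans (ltW a0)); apply: lb_le_inf => // _ [y _ <-].
    by rewrite addr_ge0// mulr_ge0.
  have /nbhs_ballP[r /= r0 rP] := lscg x a ax.
  (* [k > a] keeps the truncation above [a] within distance [r], where [g > a]; [k > a / r] makes
     the penalty alone exceed [a] beyond that distance. *)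
  pose k := (Num.trunc (Num.max a (a / r))).+1; exists k.
  have : Num.max a (a / r) < k%:R by exact: truncnS_gt.
  rewrite gt_max => /andP[ak]; rewrite ltr_pdivrMr// => ark.
  apply: lb_le_inf => // _ [y _ <-].
  have [xy|xy] := ltP `|x - y| r.
    rewrite ler_wpDr ?mulr_ge0//.
    rewrite -lee_fin mE le_min lee_fin (ltW ak) andbT; apply/ltW/rP.
    by rewrite -ball_normE.
  rewrite ler_wpDl//; apply: (le_trans (ltW ark)).
  by rewrite ler_wpM2l.
Qed.

(** * Weighted spaces of functions on matrices *)

Lemma wt_ge1 {R : realType} {m d : nat} (y : 'M[R]_(m, d)) : 1 <= wt y.
Proof. by rewrite lerDl; apply: sumr_ge0 => i _; apply: sumr_ge0. Qed.

Lemma entry_le_wt {R : realType} {m d : nat} (y : 'M[R]_(m, d)) i j :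
  `|y i j| <= wt y.
Proof.
apply: (@le_trans _ _ (\sum_(i < m) \sum_(j < d) `|y i j|)); last by rewrite lerDr.
rewrite (bigD1 i)//= (bigD1 j)//= -addrA lerDl addr_ge0//; apply: sumr_ge0 => //.
by move=> k _; apply: sumr_ge0.
Qed.

Lemma entry_le_norm {R : realType} {m d : nat} (y : 'M[R]_(m, d)) i j :
  `|y i j| <= `|y|.
Proof.
rewrite [leRHS]/Num.norm /= mx_normrE.
exact: (le_bigmax _ (fun ij => `|y ij.1 ij.2|) (i, j)).
Qed.

Lemma wt_continuous {R : realType} {m d : nat} :
  continuous (@wt R m d).
Proof.
pose k : R := \sum_(i < m) \sum_(j < d) 1.
apply: (@lipschitz_continuous _ _ k) => [|x y].
  by apply: sumr_ge0 => i _; apply: sumr_ge0.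
rewrite /wt -addrA lerD2l /k mulr_suml -big_split /=; apply: ler_sum => i _.
rewrite mulr_suml -big_split /=; apply: ler_sum => j _; rewrite mul1r addrC.
rewrite -lerBlDr; apply: le_trans (entry_le_norm _ i j); rewrite !mxE.
by rewrite lerBlDr -{1}[x i j](subrK (y i j)) ler_normD.
Qed.

Lemma vec_mx_continuous {R : realType} {m n : nat} :
  continuous (@vec_mx R m n).
Proof.
move=> v s /= /(nbhs_ballP (vec_mx v)) [e e0 es].
apply/nbhs_ballP; exists e => //= w [_ vw]; apply/es; split => // i j.
by rewrite !mxE.
Qed.

Lemma compact_wt_le {R : realType} {m n : nat} (M : R) :
  compact [set x : 'M[R]_(m, n) | wt x <= M].
Proof.
pose B := [set v : 'rV[R]_(m * n) | forall i, (`[-M, M]%classic) (v ord0 i)].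
apply: (@subclosed_compact _ _ (vec_mx @` B)).
- rewrite (_ : mkset _ = wt @^-1` [set r | r <= M])//.
  by apply: closed_comp => [x _|]; [exact: wt_continuous|exact: closed_le].
- apply: continuous_compact.
    by apply: continuous_subspaceT; exact: vec_mx_continuous.
  by apply: (@rV_compact R _ (fun=> `[-M, M]%classic)) => _; exact: segment_compact.
- move=> x /= xM; exists (mxvec x); last by rewrite mxvecK.
  move=> i /=; rewrite in_itv /= -ler_norml.
  by case/mxvec_indexP: i => i j; rewrite mxvecE; apply: le_trans xM; exact: entry_le_wt.
Qed.

Lemma closed_Omt {R : realType} {T d : nat} (K : 'I_T.+1 -> 'I_d -> set R) m :
  (forall t j, closed (K t j)) -> closed (Omt K m).
Proof.
move=> Kcl; rewrite (_ : Omt K m = \bigcap_(i in [set: 'I_m])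
   \bigcap_(j in [set: 'I_d]) (fun y : 'M[R]_(m, d) => y i j) @^-1` K (inord i) j).
  apply: closed_bigI => i _; apply: closed_bigI => j _.
  by apply: closed_comp => // x _; exact: coord_continuous.
by apply/seteqP; split => [y Ky i _ j _|y Ky i j]; [exact: Ky|exact: Ky].
Qed.

(** Near each point of [C] some [f k] is below [e] within [S], and monotonicity extends this to all
    later indices. Near-covering compactness, with the filter [\oo] on indices, then yields a common
    index. *)
Lemma dini {R : realType} {X : topologicalType} (C S : set X)
    (f : nat -> X -> R) : compact C -> C `<=` S ->
  (forall k, {within S, continuous (f k)}) ->
  (forall k x, S x -> f k.+1 x <= f k x) ->
  (forall x e, S x -> 0 < e -> exists k, f k x < e) ->
  forall e, 0 < e -> exists k, forall x, C x -> f k x < e.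
Proof.
move=> Cc CS fc fmon f0 e e0.
have fhomo x : S x -> forall m n, (m <= n)%N -> f n x <= f m x.
  move=> Sx m n mn.
  have H : {homo (fun k => - f k x) : m n / (m <= n)%N >-> m <= n}.
    by apply: homo_leq => //; [exact: le_trans|move=> k; rewrite lerN2 fmon].
  by have := H _ _ mn; rewrite lerN2.
have /compact_near_coveringP := Cc.
move=> /(_ nat \oo (fun k x => S x -> f k x < e)) [].
- move=> x Cx; have Sx := CS _ Cx.
  have [k fk] := f0 x _ Sx e0.
  have /subspace_continuousP/(_ x Sx) := fc k.
  move=> /cvgrPdist_lt/(_ (e - f k x)).
  rewrite subr_gt0 => /(_ fk); rewrite near_withinE => fkx.
  exists ([set y | S y -> `|f k x - f k y| < e - f k x], [set n | (k <= n)%N]).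
    by split => //=; exists k.
  move=> [y n] [/= Hy kn] Sy; apply: le_lt_trans (fhomo _ Sy _ _ kn) _.
  have := Hy Sy; rewrite distrC => /(le_lt_trans (ler_norm _)); lra.
- move=> N _ HN; exists N => x Cx; apply: (HN N) => //=; exact: CS.
Qed.

Lemma within_continuous_lin {R : realType} {X : topologicalType} (S : set X)
    (a : R) (f g : X -> R) : {within S, continuous f} ->
  {within S, continuous g} -> {within S, continuous (fun x => a * f x + g x)}.
Proof.
move=> /subspace_continuousP cf /subspace_continuousP cg.
apply/subspace_continuousP => x Sx.
by apply: cvgD; [apply: cvgM; [exact: cvg_cst|exact: cf]|exact: cg].
Qed.

Lemma within_continuous_norm {R : realType} {X : topologicalType} (S : set X)
    (f : X -> R) : {within S, continuous f} ->
  {within S, continuous (fun x => `|f x|)}.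
Proof.
move=> /subspace_continuousP cf; apply/subspace_continuousP => x Sx.
by apply: cvg_norm; exact: cf.
Qed.

(** Neither continuity nor measurability is included: this is the space on which the supergradient
    is built, and it contains both [Bw] and [Cw]. *)
Definition has_growth {R : realType} {m d : nat} (S : set 'M[R]_(m, d))
    (f : 'M[R]_(m, d) -> R) : Prop :=
  exists C, forall x, S x -> `|f x| <= C * wt x.

Section growth.
Context {R : realType} {m d : nat}.
Variable S : set 'M[R]_(m, d).
Implicit Types f g : 'M[R]_(m, d) -> R.

Lemma wt_ge0 (y : 'M[R]_(m, d)) : 0 <= wt y.
Proof. exact: le_trans ler01 (wt_ge1 y). Qed.

Lemma has_growth_gt0 f : has_growth S f ->
  exists2 C, 0 < C & forall x, S x -> `|f x| <= C * wt x.
Proof.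
move=> [C fC]; exists (Num.max C 1); first by rewrite lt_max ltr01 orbT.
move=> x Sx; apply: le_trans (fC x Sx) _; rewrite ler_wpM2r ?wt_ge0//.
by rewrite le_max lexx.
Qed.

Lemma has_growth_cst a : has_growth S (fun=> a).
Proof.
exists `|a| => x _; rewrite -[leLHS]mulr1 ler_wpM2l//; exact: wt_ge1.
Qed.

Lemma has_growth_wt : has_growth S wt.
Proof. by exists 1 => x _; rewrite mul1r ger0_norm// wt_ge0. Qed.

Lemma has_growth_lin a f g : has_growth S f -> has_growth S g ->
  has_growth S (fun x => a * f x + g x).
Proof.
move=> [C fC] [C' gC]; exists (`|a| * C + C') => x Sx.
rewrite (le_trans (ler_normD _ _))// mulrDl lerD ?gC// normrM -mulrA.
by rewrite ler_wpM2l// fC.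
Qed.

Lemma has_growth_norm f : has_growth S f -> has_growth S (fun x => `|f x|).
Proof. by move=> [C fC]; exists C => x Sx; rewrite normr_id fC. Qed.

Lemma has_growthD f g : has_growth S f -> has_growth S g ->
  has_growth S (fun x => f x + g x).
Proof.
move=> gf gg; have := has_growth_lin 1 _ _ gf gg.
by congr has_growth; apply/funext => x; rewrite mul1r.
Qed.

Lemma has_growthZ a f : has_growth S f -> has_growth S (fun x => a * f x).
Proof.
move=> gf; have := has_growth_lin a _ _ gf (has_growth_cst 0).
by congr has_growth; apply/funext => x; rewrite addr0.
Qed.

Lemma has_growthN f : has_growth S f -> has_growth S (fun x => - f x).
Proof.
move=> gf; have := has_growthZ (-1) _ gf.
by congr has_growth; apply/funext => x; rewrite mulN1r.
Qed.

Lemma has_growth_sum n (h : 'I_n -> 'M[R]_(m, d) -> R) :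
  (forall i, has_growth S (h i)) ->
  has_growth S (fun x => \sum_(i < n) h i x).
Proof.
elim: n h => [|n IHn] h gh.
  have := has_growth_cst 0; congr has_growth.
  by apply/funext => x; rewrite big_ord0.
have := has_growthD _ _ (IHn _ (fun i => gh (widen_ord (leqnSn n) i))) (gh ord_max).
by congr has_growth; apply/funext => x; rewrite big_ord_recr.
Qed.

End growth.

(** * Representation of tight positive functionals by Borel probabilities *)

Lemma borel_closed {R : realType} {T d : nat} (S : set 'M[R]_(T.+1, d)) :
  closed S -> measurable (S : set (Borel R T d)).
Proof.
move=> cS; rewrite -[S]setCK; apply: measurableC.
by apply: sub_sigma_algebra; exact: closed_openC.
Qed.

Lemma borel_within_continuous {R : realType} {T d : nat}
    (S : set 'M[R]_(T.+1, d)) (f : 'M[R]_(T.+1, d) -> R) : closed S ->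
  {within S, continuous f} ->
  measurable_fun (S : set (Borel R T d)) (f : Borel R T d -> R).
Proof.
move=> cS /continuousP cf.
apply: (measurability _ (RGenOpens.measurableE R)).
move=> _ [_ [a [b ->] <-]].
have /cf/open_subspaceP[V oV VS] : open `]a, b[%classic by exact: interval_open.
rewrite setIC -VS; apply: measurableI; last exact: borel_closed.
exact: sub_sigma_algebra.
Qed.

Lemma open_lsc {R : realType} {X : topologicalType} (G : set X) : open G ->
  forall x (a : R), (a%:E < (\1_G x)%:E)%E ->
  \forall y \near x, (a%:E < (\1_G y)%:E)%E.
Proof.
move=> oG x a; rewrite !lte_fin.
have [a0 _|a0] := ltP a 0.
  by near=> y; rewrite lte_fin (lt_le_trans a0)// indicE.
rewrite indicE; case: (boolP (x \in G)) => [|_]; last by rewrite ltNge a0.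
rewrite inE => Gx a1; near=> y; rewrite lte_fin indicE mem_set//.
by near: y; exact: open_nbhs_nbhs.
Unshelve. all: by end_near. Qed.

(** Tightness stands in for compactness of [S]. A sequence decreasing to 0 is bounded by [C * wt],
    hence by [C * u] where [wt > M]; on the compact rest Dini's theorem brings it below [e / 2]. So
    [f k <= C * u + e / 2] on [S] for some [k], and [l u < e / 2 / C] gives [l (f k) < e]. *)
Theorem riesz_tight {R : realType} {T d : nat} (S : set 'M[R]_(T.+1, d))
    (l : ('M[R]_(T.+1, d) -> R) -> R) : closed S ->
  (forall a f g, has_growth S f -> has_growth S g ->
    l (fun x => a * f x + g x) = a * l f + l g) ->
  (forall f, has_growth S f -> (forall x, S x -> 0 <= f x) -> 0 <= l f) ->
  l (fun=> 1) = 1 ->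
  (forall e, 0 < e -> exists u M, [/\ has_growth S u,
    forall x, S x -> 0 <= u x, forall x, S x -> M < wt x -> wt x <= u x &
    l u < e]) ->
  exists Q : probability (Borel R T d) R, Q S = 1%E /\
    forall f, {within S, continuous f} -> has_growth S f ->
      Q.-integrable S (EFin \o f) /\
      (\int[Q]_(x in S) (f x)%:E = (l f)%:E)%E.
Proof.
move=> cS llin lpos l1 ltight.
pose L := [set f : Borel R T d -> R |
   {within S, continuous (f : 'M[R]_(T.+1, d) -> R)} /\ has_growth S f].
suff [Q [QS QL]] : exists Q : probability (Borel R T d) R, Q S = 1%E /\
    forall f, L f -> Q.-integrable S (EFin \o f) /\
      (\int[Q]_(x in S) (f x)%:E = (l f)%:E)%E.
  by exists Q; split => // f cf gf; exact: QL.
have L1 : L (fun=> 1).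
  split; last exact: has_growth_cst.
  by apply: continuous_subspaceT; exact: cst_continuous.
have Llin a f g : L f -> L g -> L (fun x => a * f x + g x).
  move=> [cf gf] [cg gg]; split; last exact: has_growth_lin.
  exact: within_continuous_lin.
have Labs f : L f -> L (fun x => `|f x|).
  by move=> [cf gf]; split; [exact: within_continuous_norm|exact: has_growth_norm].
apply: (@daniell_stone _ (Borel R T d) R S L l) => //.
- by move=> a f g [_ gf] [_ gg]; exact: llin.
- by move=> f [_ gf]; exact: lpos.
- move=> f Lf fmon f0 e e0.
  have [C C0 fC] := has_growth_gt0 _ _ (Lf 0%N).2.
  have e20 : 0 < e / 2 by rewrite divr_gt0.
  have eC0 : 0 < e / 2 / C by rewrite divr_gt0.
  have [u [M [gu u0 uM lu]]] := ltight _ eC0.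
  have cC : compact ([set x | wt x <= M] `&` S).
    by apply: compact_closedI => //; exact: compact_wt_le.
  have [] := dini _ S f cC _ _ _ f0 _ e20.
  + by move=> x [].
  + by move=> k; exact: (Lf k).1.
  + by move=> k x Sx; have /andP[] := fmon k x Sx.
  move=> k fk; exists k.
  have lmono g h : has_growth S g -> has_growth S h ->
      (forall x, S x -> g x <= h x) -> l g <= l h.
    move=> gg gh gleh; rewrite -subr_ge0.
    have -> : l h - l g = l (fun x => (-1) * g x + h x) by rewrite llin//; ring.
    apply: lpos; first exact: has_growth_lin.
    by move=> x /gleh; lra.
  have ghomo x : S x -> f k x <= f 0%N x.
    move=> Sx; elim: (k) => [//|i]; apply: le_trans.
    by have /andP[] := fmon i x Sx.
  apply: (@le_lt_trans _ _ (l (fun x => C * u x + e / 2))).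
    apply: lmono; first exact: (Lf k).2.
      by apply: has_growth_lin => //; exact: has_growth_cst.
    move=> x Sx; have [xM|xM] := leP (wt x) M.
      have := fk x (conj xM Sx).
      by have := mulr_ge0 (ltW C0) (u0 x Sx); lra.
    have := ghomo x Sx; have := fC x Sx; have := ler_norm (f 0%N x).
    have : C * wt x <= C * u x by rewrite ler_pM2l// uM.
    lra.
  have lcst a : l (fun=> a) = a.
    transitivity (l (fun x => (a - 1) * 1 + 1)).
      by congr l; apply/funext => x; ring.
    by rewrite llin ?l1; [ring|exact: has_growth_cst|exact: has_growth_cst].
  rewrite llin//; last exact: has_growth_cst.
  by move: lu; rewrite lcst ltr_pdivlMr//; lra.
- exact: borel_closed.
- by move=> f [cf _]; exact: borel_within_continuous.
- move=> A; apply: smallest_sub; first exact: smallest_sigma_algebra.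
  move=> G oG.
  (* The indicator of an open set is lower semicontinuous; the continuous functions increasing to it
     exhibit [G] as the union of the sets [0 < h k], which are of the generating kind. *)
  have [||h [hc h0 hk hG Gh]] := @lsc_approx R 'M[R]_(T.+1, d) (fun x => (\1_G x)%:E).
    by move=> x; rewrite lee_fin indicE.
    exact: open_lsc.
  rewrite (_ : G = \bigcup_k [set x | 0 < h k x]).
    apply: sigma_algebra_bigcup => k; apply: sub_sigma_algebra.
    exists (h k) => //; split; first exact: continuous_subspaceT.
    exists k%:R => x _; rewrite ger0_norm; last by have /andP[] := h0 k x.
    by rewrite (le_trans (hk k x))// ler_peMr// wt_ge1.
  apply/seteqP; split => [x Gx|x [k _ /= hx]].
    have [|k hx] := Gh x (1 / 2); first by rewrite lte_fin indicE mem_set//=; lra.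
    by exists k => //=; apply: lt_le_trans hx; rewrite divr_gt0.
  apply: contrapT => nGx; have := hG k x.
  by rewrite lee_fin indicE memNset//= leNgt hx.
Qed.

(** * Comparison of extended reals, and integrals against a probability carried by [S] *)

Lemma ereal_lt_between {R : realType} (x y : \bar R) : (x < y)%E ->
  exists r : R, (x < r%:E < y)%E.
Proof.
case: x y => [x| |] [y| |] //= xy.
- by exists ((x + y) / 2); move: xy; rewrite !lte_fin; lra.
- by exists (x + 1); rewrite lte_fin ltry andbT; lra.
- by exists (y - 1); rewrite lte_fin ltNyr /=; lra.
- by exists 0; rewrite ltNyr ltry.
Qed.

Lemma ereal_le_of_lt {R : realType} (x y : \bar R) :
  (forall r : R, (r%:E < x)%E -> (r%:E <= y)%E) -> (x <= y)%E.
Proof.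
move=> H; rewrite leNgt; apply/negP => /ereal_lt_between[r /andP[yr rx]].
by have := H r rx; rewrite leNgt yr.
Qed.

Section full_set.
Import HBNNSimple.
Context {d0 : measure_display} {X : measurableType d0} {R : realType}.
Variables (Q : probability X R) (S : set X).
Hypotheses (mS : measurable S) (QS : Q S = 1%E).

Let QSC : Q (~` S) = 0%E.
Proof. by rewrite probability_setC// QS subee. Qed.

(* No measurability is assumed: the integral of a nonnegative function is the
   supremum of the integrals of the simple functions below it, and these can be
   cut off outside of [S]. *)
Lemma ge0_le_integral_full_set (f g : X -> \bar R) :
  (forall x, 0 <= f x)%E -> (forall x, 0 <= g x)%E ->
  (forall x, S x -> f x <= g x)%E ->
  (\int[Q]_(x in setT) f x <= \int[Q]_(x in setT) g x)%E.
Proof.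
move=> f0 g0 fg; rewrite !ge0_integralTE//.
apply: ge_ereal_sup => _ [h /= hf <-].
apply: ereal_sup_ubound; exists (proj_nnsfun h mS) => /=.
  move=> x; rewrite mindicE; case: (boolP (x \in S)) => [|_].
    by rewrite inE mulr1 => Sx; exact: le_trans (hf x) (fg x Sx).
  by rewrite mulr0.
have cut (k : {nnsfun X >-> R}) :
    sintegral Q k = (\int[Q]_(x in S) (k x)%:E)%E.
  rewrite -integralT_nnsfun (@ge0_negligible_integral _ _ _ Q setT (~` S))//.
  - by rewrite setTD setCK.
  - exact: measurableC.
  - by apply/measurable_EFinP.
  - by move=> x _; rewrite lee_fin.
rewrite !cut; apply: eq_integral => x xS /=.
by rewrite mindicE xS mulr1.
Qed.

(** Serves [weak_duality], where [c] carries no measurability and [EQ] integrates over all matrices,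
    although the inequality is known on [S] only. *)
Lemma le_integral_full_set (f g : X -> \bar R) :
  (forall x, S x -> f x <= g x)%E ->
  (\int[Q]_(x in setT) f x <= \int[Q]_(x in setT) g x)%E.
Proof.
move=> fg; rewrite integralE [leRHS]integralE; apply: leeB.
  apply: ge0_le_integral_full_set => // x Sx.
  by rewrite !funeposE ge_max !le_max fg// lexx orbT.
apply: ge0_le_integral_full_set => // x Sx.
by rewrite !funenegE ge_max !le_max leeN2 fg// lexx orbT.
Qed.

Lemma integral_full_set (f : X -> \bar R) :
  (\int[Q]_(x in setT) f x = \int[Q]_(x in S) f x)%E.
Proof.
rewrite [RHS]integral_mkcond; apply/eqP; rewrite eq_le.
by apply/andP; split; apply: le_integral_full_set => x Sx; rewrite patchE mem_set.
Qed.

End full_set.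

Lemma lsc_on_approx {R : realType} {m d : nat} (S : set 'M[R]_(m, d))
    (c : 'M[R]_(m, d) -> \bar R) (C : R) : closed S -> lsc_on S c ->
  (forall x, S x -> ((- (C * wt x))%:E <= c x)%E) ->
  exists h : nat -> 'M[R]_(m, d) -> R, [/\ forall k, continuous (h k),
    forall k x, 0 <= h k x <= h k.+1 x, forall k x, h k x <= k%:R,
    forall k x, S x -> ((h k x)%:E <= c x + (C * wt x)%:E)%E &
    forall x, S x -> (h k x)%:E @[k --> \oo] --> (c x + (C * wt x)%:E)%E].
Proof.
move=> cS lscc cC.
(* Adding [C * wt] makes the function nonnegative, and the value [+oo] off the closed set [S] keeps
   it lower semicontinuous on the whole space, as [lsc_approx] requires. *)
pose g x := if x \in S then (c x + (C * wt x)%:E)%E else +oo%E.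
have gS x : S x -> g x = (c x + (C * wt x)%:E)%E by move=> Sx; rewrite /g mem_set.
have [||h [hc h0 hk hg gh]] := lsc_approx g.
- move=> x; rewrite /g; case: ifP => //; rewrite inE => Sx.
  by rewrite -leeBlDr// sub0e cC.
- move=> x a; have [Sx|nSx] := pselect (S x); last first.
    move=> _; near=> y; rewrite /g memNset ?ltry//.
    by near: y; apply: open_nbhs_nbhs; split => //; exact: closed_openC.
  rewrite gS// -lteBlDr// -EFinB => /ereal_lt_between[s /andP[as_ sc]].
  have cy := lscc x Sx s sc.
  have wc : {for x, continuous (fun y : 'M[R]_(m, d) => C * wt y)}.
    by apply: continuousM; [exact: cst_continuous|exact: wt_continuous].
  have wy : \forall y \near x, a - s < C * wt y.
    by apply: (cvgr_gt (C * wt x) wc); move: as_; rewrite lte_fin; lra.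
  apply: filterS2 cy wy => y cy wy; rewrite /g; case: ifP; rewrite ?ltry//.
  rewrite inE => Sy; rewrite -lteBlDr// -EFinB; apply: le_lt_trans (cy Sy).
  by rewrite lee_fin; lra.
exists h; split => //; first by move=> k x Sx; rewrite -gS.
move=> x Sx; rewrite -gS//.
have -> : g x = ereal_sup (range (fun k => (h k x)%:E)).
  apply/eqP; rewrite eq_le; apply/andP; split.
    apply: ereal_le_of_lt => r /gh[k rk]; apply: (@le_trans _ _ (h k x)%:E).
      by rewrite lee_fin.
    by apply: ereal_sup_ubound; exists k.
  by apply: ge_ereal_sup => _ [k _ <-].
apply: ereal_nondecreasing_cvgn; apply: homo_leq => //; first exact: le_trans.
by move=> k; rewrite lee_fin; have /andP[] := h0 k x.
Unshelve. all: by end_near. Qed.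

Lemma wt_projt {R : realType} {T d : nat} (t : 'I_T.+1) (x : 'M[R]_(T.+1, d)) :
  wt (projt t x) <= wt x.
Proof.
rewrite /wt lerD2l.
pose F k := \sum_(j < d) `|x (inord k) j|.
have -> : \sum_(i < T.+1) \sum_(j < d) `|x i j| = \sum_(i < T.+1) F i.
  by apply: eq_bigr => i _; apply: eq_bigr => j _; rewrite inord_val.
have -> : \sum_(i < t.+1) \sum_(j < d) `|projt t x i j| = \sum_(i < t.+1) F i.
  apply: eq_bigr => i _; apply: eq_bigr => j _; rewrite mxE.
  by congr (`|x _ _|); apply/val_inj; rewrite /= inordK// (leq_trans (ltn_ord i)).
rewrite (big_ord_widen _ F (ltn_ord t)) big_mkcond /=.
by apply: ler_sum => i _; case: ifP => // _; apply: sumr_ge0.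
Qed.

Lemma projt_continuous {R : realType} {T d : nat} (t : 'I_T.+1) :
  continuous (@projt R T d t).
Proof.
move=> x s /= /(nbhs_ballP (projt t x)) [e e0 es].
apply/nbhs_ballP; exists e => //= y [_ xy]; apply/es; split => // i j.
by rewrite !mxE.
Qed.

Lemma within_continuous_sum {R : realType} {X : topologicalType} (S : set X) n
    (h : 'I_n -> X -> R) : (forall i, {within S, continuous (h i)}) ->
  {within S, continuous (fun x => \sum_(i < n) h i x)}.
Proof.
elim: n h => [|n IHn] h ch.
  rewrite (_ : (fun x => _) = fun=> 0); last by apply/funext => x; rewrite big_ord0.
  by apply: continuous_subspaceT; exact: cst_continuous.
have := within_continuous_lin S 1 _ _
  (IHn _ (fun i => ch (widen_ord (leqnSn n) i))) (ch ord_max).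
rewrite (_ : (fun x => 1 * _ + _) = (fun x => \sum_(i < n.+1) h i x))//.
by apply/funext => x; rewrite big_ord_recr /= mul1r.
Qed.

(** * Superhedging functional and duality *)

Lemma half_gt0_lt1 {R : realType} : 0 < (2^-1 : R) < 1.
Proof. by apply/andP; split; lra. Qed.

Section market.
Context {R : realType} {d T : nat}.
Variables (K : 'I_T.+1 -> 'I_d -> set R)
  (E : forall t : 'I_T.+1, set ('M[R]_(t.+1, d) -> R))
  (U : Phi R T d -> \bar R) (A : set ('M[R]_(T.+1, d) -> R)).
Hypothesis Egood : good_E K E.
Hypothesis Uconc : concave_U E U.
Hypothesis U0 : U zeroPhi \is a fin_num.
Hypothesis Acone : convex_cone A.

Local Notation P := (Pfrak K E U A).

Definition payoff (p : Phi R T d) (x : 'M[R]_(T.+1, d)) : R :=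
  \sum_(t < T.+1) p t (projt t x).

Lemma Omt_projt (t : 'I_T.+1) x : Om K x -> Omt K t.+1 (projt t x).
Proof. by move=> Kx i j; rewrite mxE; exact: (Kx (widen_ord (ltn_ord t) i) j). Qed.

Lemma inEall_addcst p beta : inEall E p -> inEall E (addcst K p beta).
Proof. by move=> Ep t; have [_ [Ec [ED _]]] := Egood t; apply: ED. Qed.

Lemma inEall_scale a p : inEall E p -> inEall E (scalePhi a p).
Proof. by move=> Ep t; have [_ [_ [_ EZ]]] := Egood t; exact: EZ. Qed.

Lemma inEall_add p q : inEall E p -> inEall E q -> inEall E (addPhi p q).
Proof. by move=> Ep Eq t; have [_ [_ [ED _]]] := Egood t; exact: ED. Qed.

Lemma oppPhiE (p : Phi R T d) : oppPhi p = scalePhi (-1) p.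
Proof.
by apply: functional_extensionality_dep => t; apply/funext => y;
  rewrite /oppPhi /scalePhi mulN1r.
Qed.

Lemma inEall_opp p : inEall E p -> inEall E (oppPhi p).
Proof. by rewrite oppPhiE; exact: inEall_scale. Qed.

Lemma inEall_zero : inEall E zeroPhi.
Proof.
move=> t; have [_ [Ec _]] := Egood t; have := Ec 0.
by congr (E t); apply/funext => y; rewrite /cstO; case: ifP.
Qed.

Lemma payoff_addcst p beta x : Om K x ->
  payoff (addcst K p beta) x = payoff p x + \sum_(t < T.+1) beta t.
Proof.
move=> Kx; rewrite /payoff -big_split /=; apply: eq_bigr => t _.
rewrite /addcst /cstO /=; case: asboolP => // nK; exfalso; apply: nK.
exact: Omt_projt.
Qed.

Lemma payoff_scale a p x : payoff (scalePhi a p) x = a * payoff p x.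
Proof. by rewrite /payoff mulr_sumr. Qed.

Lemma payoff_opp p x : payoff (oppPhi p) x = - payoff p x.
Proof. by rewrite oppPhiE payoff_scale mulN1r. Qed.

Lemma payoff_add p q x : payoff (addPhi p q) x = payoff p x + payoff q x.
Proof. by rewrite /payoff -big_split. Qed.

(** Left to right, the strict inequality selects [q] in the outer supremum and [beta] in [SU]; [p]
    is [q] shifted by [beta], and [b] is the sum of [beta]. Right to left, the shift is undone, and
    the strict inequality places the result in [domSU]. *)
Lemma lt_Pfrak (r : R) c : (r%:E < P c)%E <->
  exists p a b, [/\ inEall E p, A a,
    forall x, Om K x -> ((payoff p x - a x - b)%:E <= c x)%E &
    ((r + b)%:E < U p)%E].
Proof.
split=> [/ereal_sup_gt[_ [q [a Aa [[Eq _] qc]] <-]]|].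
  move=> /ereal_sup_gt[_ [beta _ <-]].
  rewrite lteBrDr// -EFinD => rU.
  exists (addcst K q beta), a, (\sum_(t < T.+1) beta t); split => //.
    exact: inEall_addcst.
  move=> x Kx; rewrite payoff_addcst//.
  by have := qc x Kx; congr (_%:E <= _)%E; rewrite /payoff; ring.
move=> [p [a [b [Ep Aa pc rb]]]].
(* Only the total of the shifts matters; all of it is placed at time 0. *)
pose beta (t : 'I_T.+1) := if t == ord0 then b else 0.
have sbeta : \sum_(t < T.+1) beta t = b.
  rewrite (bigD1 ord0)//= big1 ?addr0 /beta ?eqxx//.
  by move=> t /negbTE ->.
pose q := addcst K p (fun t => - beta t).
have qp : addcst K q beta = p.
  apply: functional_extensionality_dep => t; apply/funext => y.
  by rewrite /q /addcst /cstO /=; case: ifP; rewrite ?addr0 ?subrK.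
have rSU : (r%:E < SU K U q)%E.
  apply: (@lt_le_trans _ _ (U (addcst K q beta) - (\sum_(t < T.+1) beta t)%:E)%E).
    by rewrite qp sbeta lteBrDr.
  by apply: ereal_sup_ubound; exists beta.
apply: (lt_le_trans rSU); apply: ereal_sup_ubound; exists q => //.
exists a => //; split; first split.
- exact: inEall_addcst.
- by apply: lt_trans rSU; exact: ltNyr.
move=> x Kx; apply: le_trans (pc x Kx); rewrite lee_fin -/(payoff q x).
by rewrite payoff_addcst// sumrN sbeta; lra.
Qed.

(** The costs are compared through real numbers below them, so that a convex combination of infinite
    values never has to be formed. *)
Lemma Pfrak_convex_comb c1 c2 c3 (l r1 r2 : R) : 0 < l < 1 ->
  (forall x s1 s2, Om K x -> (s1%:E <= c1 x)%E -> (s2%:E <= c2 x)%E ->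
    ((l * s1 + (1 - l) * s2)%:E <= c3 x)%E) ->
  (r1%:E < P c1)%E -> (r2%:E < P c2)%E ->
  ((l * r1 + (1 - l) * r2)%:E < P c3)%E.
Proof.
move=> l01 c123 /lt_Pfrak[p1 [a1 [b1 [E1 A1 pc1 U1]]]].
move=> /lt_Pfrak[p2 [a2 [b2 [E2 A2 pc2 U2]]]]; apply/lt_Pfrak.
have /andP[l0 l1] := l01.
exists (addPhi (scalePhi l p1) (scalePhi (1 - l) p2)).
exists (fun x => l * a1 x + (1 - l) * a2 x), (l * b1 + (1 - l) * b2).
split.
- by apply: inEall_add; exact: inEall_scale.
- have [_ [AD AZ]] := Acone.
  by apply: AD; apply: AZ => //; lra.
- move=> x Kx; have := c123 x _ _ Kx (pc1 x Kx) (pc2 x Kx).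
  by congr (_%:E <= _)%E; rewrite payoff_add !payoff_scale; ring.
- apply: lt_le_trans (Uconc.2 _ _ _ E1 E2 l01).
  have := Uconc.1 _ E1; have := Uconc.1 _ E2; move: U1 U2.
  case: (U p1) (U p2) => [u1| |] [u2| |] //; rewrite !lte_fin => U1 U2 _ _.
  by nra.
Qed.

Lemma le_Pfrak c1 c2 : (forall x, Om K x -> (c1 x <= c2 x)%E) ->
  (P c1 <= P c2)%E.
Proof.
move=> c12; apply: ereal_le_of_lt => r /lt_Pfrak[p [a [b [Ep Aa pc Ur]]]].
apply/ltW/lt_Pfrak; exists p, a, b; split=> // x Kx.
exact: le_trans (pc x Kx) (c12 x Kx).
Qed.

Lemma eq_Pfrak c1 c2 : (forall x, Om K x -> c1 x = c2 x) -> P c1 = P c2.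
Proof.
move=> c12; apply/eqP; rewrite eq_le.
by apply/andP; split; apply: le_Pfrak => x Kx; rewrite c12.
Qed.

Lemma Pfrak_cash_additive c (k : R) : P (fun x => c x + k%:E)%E = (P c + k%:E)%E.
Proof.
apply/eqP; rewrite eq_le; apply/andP; split; last first.
  rewrite -leeBrDr//; apply: ereal_le_of_lt => r /lt_Pfrak.
  move=> [p [a [b [Ep Aa pc Ur]]]]; rewrite leeBrDr// -EFinD.
  apply/ltW/lt_Pfrak; exists p, a, (b - k); split=> //; last first.
    by have := Ur; congr (_%:E < _)%E; ring.
  move=> x Kx; apply: le_trans (leeD (pc x Kx) (lexx k%:E)).
  by rewrite -EFinD lee_fin; lra.
apply: ereal_le_of_lt => r /lt_Pfrak[p [a [b [Ep Aa pc Ur]]]].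
rewrite -leeBlDr// -EFinB.
apply/ltW/lt_Pfrak; exists p, a, (b + k); split=> //; last first.
  by have := Ur; congr (_%:E < _)%E; ring.
move=> x Kx; rewrite (_ : _ - _ = payoff p x - a x - b - k); last by ring.
by rewrite EFinB leeBlDr// pc.
Qed.

Lemma Pfrak_subA c z : A z -> (P c <= P (fun x => c x - (z x)%:E))%E.
Proof.
move=> Az; apply: ereal_le_of_lt => r /lt_Pfrak[p [a [b [Ep Aa pc Ur]]]].
apply/ltW/lt_Pfrak; exists p, (a \+ z), b; split=> //.
  by have [_ [AD _]] := Acone; exact: AD.
move=> x Kx; rewrite leeBrDr// -EFinD; apply: le_trans (pc x Kx).
by rewrite lee_fin /=; lra.
Qed.

Lemma U_le_Pfrak p c : inEall E p ->
  (forall x, Om K x -> ((payoff p x)%:E <= c x)%E) -> (U p <= P c)%E.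
Proof.
move=> Ep pc; apply: ereal_le_of_lt => r rU; apply/ltW/lt_Pfrak.
exists p, (fun=> 0), 0; split=> //; last by rewrite addr0.
  by have [] := Acone.
by move=> x Kx; rewrite !subr0 pc.
Qed.

Hypothesis Kclosed : forall t j, closed (K t j).
Hypothesis Acont : A `<=` Cw (Om K).
Local Notation S := (Om K).

Let Sclosed : closed S.
Proof. exact: closed_Omt. Qed.

Let mS : measurable (S : set (Borel R T d)).
Proof. exact: borel_closed. Qed.

Lemma has_growth_component t p : inEall E p ->
  has_growth S (fun x => p t (projt t x)).
Proof.
move=> Ep; have [/(_ _ (Ep t))[_ [_ [C pC]]] _] := Egood t.
exists (Num.max C 0) => x Kx; apply: le_trans (pC _ (Omt_projt t x Kx)) _.
apply: (@le_trans _ _ (Num.max C 0 * wt (projt t x))).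
  by rewrite ler_wpM2r ?wt_ge0// le_max lexx.
by rewrite ler_wpM2l ?wt_projt// le_max lexx orbT.
Qed.

Lemma has_growth_payoff p : inEall E p -> has_growth S (payoff p).
Proof. by move=> Ep; apply: has_growth_sum => t; exact: has_growth_component. Qed.

Lemma continuous_component t p : inEall E p ->
  {within S, continuous (fun x => p t (projt t x))}.
Proof.
move=> Ep; have [/(_ _ (Ep t))[/subspace_continuousP cp _] _] := Egood t.
apply/subspace_continuousP => x Kx.
have /cp cpx := Omt_projt t x Kx.
apply: (cvg_comp _ _ _ cpx) => V VE.
have {}VE : nbhs (projt t x) [set y | Omt K t.+1 y -> V y] := VE.
have := @projt_continuous R T d t x _ VE.
rewrite /nbhs_simpl => nV; suff : nbhs x [set y | S y -> V (projt t y)] by [].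
apply: (@filterS _ (nbhs x) (nbhs_filter x) _ _ _ nV) => y Vy Ky.
by apply: Vy; exact: Omt_projt.
Qed.

Lemma continuous_payoff p : inEall E p -> {within S, continuous (payoff p)}.
Proof.
by move=> Ep; apply: within_continuous_sum => t; exact: continuous_component.
Qed.

Lemma polar_growth z : A z -> {within S, continuous z} /\ has_growth S z.
Proof. by move=> /Acont[cz [_ gz]]. Qed.

(** * Each admissible measure bounds the superhedging value from above *)

Section weak_duality.
Variable Q : probability (Borel R T d) R.
Hypothesis Q1 : Prob1 K Q.
Hypothesis QA : polarA A Q.

Let QS : Q S = 1%E := Q1.1.

Lemma integrable_entry i j :
  Q.-integrable S (fun x : 'M[R]_(T.+1, d) => (`|x i j|)%:E).
Proof.
apply/integrableP; split.
  apply/measurable_EFinP; apply: (borel_within_continuous S) => //.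
  apply: within_continuous_norm; apply: continuous_subspaceT.
  exact: coord_continuous.
under eq_integral do rewrite /= normr_id.
by rewrite -integral_full_set//; exact: Q1.2.
Qed.

Lemma integrable_wt : Q.-integrable S (fun x : 'M[R]_(T.+1, d) => (wt x)%:E).
Proof.
have -> : (fun x : 'M[R]_(T.+1, d) => (wt x)%:E) =
    (fun x => 1%:E + \sum_(i < T.+1) \sum_(j < d) (`|x i j|)%:E)%E.
  apply/funext => x; rewrite /wt EFinD; congr (_ + _)%E.
  by rewrite -sumEFin; apply: eq_bigr => i _; rewrite -sumEFin.
apply: integrableD => //; first exact: finite_measure_integrable_cst.
apply: integrable_sum => // i _; apply: integrable_sum => // j _.
exact: integrable_entry.
Qed.

Lemma integrable_growth g : {within S, continuous g} -> has_growth S g ->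
  Q.-integrable S (fun x : 'M[R]_(T.+1, d) => (g x)%:E).
Proof.
move=> cg [C gC].
apply: (@le_integrable _ _ _ Q S mS _ (fun x : 'M[R]_(T.+1, d) => C%:E * (wt x)%:E)%E).
- by apply/measurable_EFinP; exact: borel_within_continuous.
- move=> x Sx; rewrite lee_fin; apply: le_trans (gC x Sx) _; exact: ler_norm.
- by apply: integrableZl => //; exact: integrable_wt.
Qed.

Lemma sum_EQ_payoff p : inEall E p ->
  (\sum_(t < T.+1) EQ Q (fun x => (p t (projt t x))%:E) =
   \int[Q]_(x in S) (payoff p x)%:E)%E.
Proof.
move=> Ep; under eq_bigr do rewrite /EQ (integral_full_set Q S)//.
rewrite -integral_sum// => [|t].
  by apply: eq_integral => x _; rewrite sumEFin.
by apply: integrable_growth; [exact: continuous_component|exact: has_growth_component].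
Qed.

(** For a triple given by [lt_Pfrak], [E_Q[c] >= ep - ea - b] and [D(Q) >= u - ep]. The integral
    [ep] of the payoff cancels, and [ea <= 0] by polarity, which leaves at least [u - b > r]. Both
    lower bounds are real, so the sum raises no question of infinities. *)
Lemma weak_duality c : (P c <= EQ Q c + DQ E U Q)%E.
Proof.
apply: ereal_le_of_lt => r /lt_Pfrak[p [a [b [Ep Aa pc rU]]]].
have [ca ga] := polar_growth _ Aa.
have ipay := integrable_growth _ (continuous_payoff _ Ep) (has_growth_payoff _ Ep).
have ia := integrable_growth _ ca ga.
pose ep : R := fine (\int[Q]_(x in S) (payoff p x)%:E).
have epE : (\int[Q]_(x in S) (payoff p x)%:E = ep%:E)%E.
  by rewrite fineK//; exact: integrable_fin_num.
pose ea : R := fine (\int[Q]_(x in S) (a x)%:E).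
have eaE : (\int[Q]_(x in S) (a x)%:E = ea%:E)%E.
  by rewrite fineK//; exact: integrable_fin_num.
have ea0 : ea <= 0.
  have := QA _ Aa; rewrite (integral_full_set Q S)//.
  by rewrite [leLHS]eaE lee_fin.
have := sum_EQ_payoff _ Ep; rewrite epE => sumE.
have [u Uu] : exists u, U p = u%:E.
  move: rU (Uconc.1 _ Ep); case: (U p) => // u _ _; by exists u.
rewrite Uu lte_fin in rU.
have Dge : ((u - ep)%:E <= DQ E U Q)%E.
  by apply: ereal_sup_ubound; exists p => //; rewrite Uu sumE.
have cstE : (\int[Q]_(x in S) b%:E = b%:E)%E.
  by transitivity (b%:E * Q S)%E; [exact: integral_cst|rewrite QS mule1].
have Ege : ((ep - ea - b)%:E <= EQ Q c)%E.
  apply: (@le_trans _ _ (\int[Q]_(x in setT) (payoff p x - a x - b)%:E)%E).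
    rewrite (integral_full_set Q S)//.
    under eq_integral do rewrite EFinB.
    rewrite integralB//; last exact: finite_measure_integrable_cst.
      under eq_integral do rewrite EFinB.
      rewrite integralB// cstE [X in (_ <= X - _ - _)%E]epE.
      by rewrite [X in (_ <= _ - X - _)%E]eaE.
    exact: (integrableB mS ipay ia).
  by apply: (le_integral_full_set Q S).
apply: le_trans (leeD Ege Dge); rewrite -EFinD lee_fin; lra.
Qed.

End weak_duality.
(* Hypothesis (ii) enters the proof only through this consequence. *)
Definition tight_family (f : nat -> Phi R T d) (M : nat -> R) : Prop :=
  [/\ forall n, inEall E (f n),
      forall n (t : 'I_T.+1) y, Omt K t.+1 y -> 0 <= f n t y,
      forall n, 0 <= M n,
      forall n x, Om K x -> M n < wt x -> wt x <= payoff (f n) x &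
      forall G, 0 < G -> exists n, ((-1)%:E < U (oppPhi (scalePhi G (f n))))%E].

Variables (f : nat -> Phi R T d) (M : nat -> R).
Hypothesis ftight : tight_family f M.

Lemma payoff_ge0 n x : Om K x -> 0 <= payoff (f n) x.
Proof.
move=> Kx; apply: sumr_ge0 => t _; have [_ f0 _ _ _] := ftight.
by apply: f0; exact: Omt_projt.
Qed.

(** The position [- G * f n] together with the cash [- G * M n] stays below [- C * wt]: where
    [wt <= M n] the cash is enough, elsewhere [payoff (f n) >= wt] is. Its value exceeds
    [- 1 - G * M n]. *)
Lemma Pfrak_gtNy c (C : R) : (forall x, Om K x -> ((- (C * wt x))%:E <= c x)%E) ->
  (-oo < P c)%E.
Proof.
move=> cC; have [Ef _ M0 wf Uf] := ftight.
pose G := Num.max C 1; have G0 : 0 < G by rewrite lt_max ltr01 orbT.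
have [n Un] := Uf G G0.
apply: (@lt_trans _ _ (- 1 - G * M n)%:E); first exact: ltNyr.
apply/lt_Pfrak; exists (oppPhi (scalePhi G (f n))), (fun=> 0), (G * M n); split.
- exact/inEall_opp/inEall_scale.
- by have [] := Acone.
- move=> x Kx; apply: le_trans (cC x Kx); rewrite lee_fin payoff_opp payoff_scale.
  have CG : C * wt x <= G * wt x.
    by rewrite ler_wpM2r ?wt_ge0// le_max lexx.
  have := payoff_ge0 n x Kx => f0.
  have := M0 n; have [wM|/(wf n x Kx)wM] := leP (wt x) (M n).
    have : 0 <= G * (M n - wt x) by rewrite mulr_ge0 ?subr_ge0// ltW.
    have : 0 <= G * payoff (f n) x by rewrite mulr_ge0// ltW.
    by lra.
  move=> Mn; have : 0 <= G * (payoff (f n) x - wt x).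
    by rewrite mulr_ge0 ?subr_ge0// ltW.
  have : 0 <= G * M n by rewrite mulr_ge0// ltW.
  by lra.
- by rewrite subrK.
Qed.

(** * The value as a function of a perturbation of linear growth around a fixed cost *)

Section perturbation.
Variables (c : 'M[R]_(T.+1, d) -> \bar R) (C : R).
Hypothesis cC : forall x, Om K x -> ((- (C * wt x))%:E <= c x)%E.
Hypothesis Pc : (P c < +oo)%E.

Definition perturbed (h : 'M[R]_(T.+1, d) -> R) : \bar R :=
  P (fun x => (h x)%:E + c x)%E.

Local Notation growth := (has_growth (Om K)).

Lemma perturbed_gtNy h : growth h -> (-oo < perturbed h)%E.
Proof.
move=> [C' hC']; apply: (@Pfrak_gtNy _ (C' + C)) => x Kx.
rewrite mulrDl opprD EFinD leeD ?cC// lee_fin.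
by have := hC' x Kx; rewrite ler_norml => /andP[].
Qed.

Lemma perturbed_convex_comb h1 h2 (l r1 r2 : R) : 0 < l < 1 ->
  (r1%:E < perturbed h1)%E -> (r2%:E < perturbed h2)%E ->
  ((l * r1 + (1 - l) * r2)%:E <
    perturbed (fun x => l * h1 x + (1 - l) * h2 x)%R)%E.
Proof.
move=> l01; apply: Pfrak_convex_comb => // x s1 s2 Kx.
have /andP[l0 l1] := l01.
by case: (c x) => [r| |] //; rewrite ?leey// -!EFinD !lee_fin; nra.
Qed.

Lemma perturbed0 : perturbed (fun=> 0) = P c.
Proof. by apply: eq_Pfrak => x _; rewrite add0e. Qed.

Lemma perturbed_fin h : growth h -> perturbed h \is a fin_num.
Proof.
move=> gh; rewrite fin_numElt perturbed_gtNy//= ltNge leye_eq; apply/negP => /eqP hy.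
have Pcfin : P c \is a fin_num.
  rewrite fin_numElt Pc andbT -perturbed0; apply: perturbed_gtNy.
  exact: has_growth_cst.
have /ereal_lt_between[r2 /andP[_ hr2]] := perturbed_gtNy _ (has_growthN _ _ gh).
(* Chosen so that its midpoint with [r2] is the value at [c], which would then lie strictly below
   itself. *)
have hr1 : ((2 * fine (P c) - r2)%:E < perturbed h)%E by rewrite hy ltry.
have l01 := @half_gt0_lt1 R.
have := perturbed_convex_comb _ _ _ _ _ l01 hr1 hr2.
rewrite (_ : (fun x => _) = fun=> 0); last first.
  by apply/funext => x; field.
rewrite perturbed0 (_ : _ + _ = fine (P c)); last by field.
by rewrite fineK// ltxx.
Qed.

Lemma perturbed_concave h1 h2 l : growth h1 -> growth h2 -> 0 < l < 1 ->
  l * fine (perturbed h1) + (1 - l) * fine (perturbed h2) <=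
  fine (perturbed (fun x => l * h1 x + (1 - l) * h2 x)).
Proof.
move=> g1 g2 l01; apply/ler_addgt0Pr => e e0.
have lt_fine h : growth h -> ((fine (perturbed h) - e)%:E < perturbed h)%E.
  move=> gh; have ph := perturbed_fin _ gh.
  by rewrite EFinB fineK// lteBlDr// lteDl// lte_fin.
have := perturbed_convex_comb _ _ _ _ _ l01 (lt_fine _ g1) (lt_fine _ g2).
have gl : growth (fun x => l * h1 x + (1 - l) * h2 x).
  by apply: has_growth_lin => //; exact: has_growthZ.
rewrite -[X in (_ < X)%E](fineK (perturbed_fin _ gl)) lte_fin.
by move=> /ltW; lra.
Qed.

Lemma perturbed_mono h1 h2 : growth h1 -> growth h2 ->
  (forall x, Om K x -> h1 x <= h2 x) ->
  fine (perturbed h1) <= fine (perturbed h2).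
Proof.
move=> g1 g2 h12; apply: fine_le; [exact: perturbed_fin|exact: perturbed_fin|].
by apply: le_Pfrak => x Kx; rewrite leeD2r// lee_fin h12.
Qed.

Lemma perturbed_cst k :
  fine (perturbed (fun=> k)) = fine (P c) + k.
Proof.
have Pcfin : P c \is a fin_num.
  by rewrite -perturbed0 perturbed_fin//; exact: has_growth_cst.
have : perturbed (fun=> k) = (P c + k%:E)%E.
  by rewrite -Pfrak_cash_additive; apply: eq_Pfrak => x _; rewrite addeC.
by move=> ->; rewrite fineD.
Qed.

(** Monotonicity squeezes [h] between [- delta * wt] and [delta * wt]. Concavity bounds both ends by
    the value at [- wt]: the weight [l = 1 / (1 + delta)] writes 0 as a combination of [delta * wt]
    and [- wt], and the weight [delta] writes [- delta * wt] as one of [- wt] and 0. *)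
Lemma perturbed_lipschitz h (delta : R) : growth h -> 0 < delta < 1 ->
  (forall x, Om K x -> `|h x| <= delta * wt x) ->
  `|fine (perturbed h) - fine (P c)| <=
    delta * (fine (P c) - fine (perturbed (fun x => - wt x))).
Proof.
move=> gh /andP[d0 d1] hd.
have gw := has_growth_wt S.
have gdw := has_growthZ _ delta _ gw; have gNw := has_growthN _ _ gw.
have gNdw := has_growthN _ _ gdw.
have upper : fine (perturbed h) <= fine (perturbed (fun x => delta * wt x)).
  apply: perturbed_mono => // x Sx.
  by have := hd x Sx; rewrite ler_norml => /andP[].
have lower : fine (perturbed (fun x => - (delta * wt x))) <= fine (perturbed h).
  apply: perturbed_mono => // x Sx.
  by have := hd x Sx; rewrite ler_norml => /andP[].
pose l := (1 + delta)^-1.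
have ld : 1 - l = delta * l by rewrite /l; field; lra.
have l0 : 0 < l by rewrite invr_gt0; lra.
have ldl : l * (1 + delta) = 1 by rewrite /l mulVf//; lra.
have l01 : 0 < l < 1 by rewrite l0 /=; nra.
have := perturbed_concave _ _ _ gdw gNw l01.
rewrite (_ : (fun x => l * _ + _) = fun=> 0); last first.
  by apply/funext => x; rewrite ld; ring.
rewrite perturbed0 ld => C1.
have d01 : 0 < delta < 1 by rewrite d0.
have := perturbed_concave _ _ _ gNw (has_growth_cst S 0) d01.
rewrite (_ : (fun x => delta * _ + _) = fun x => - (delta * wt x)); last first.
  by apply/funext => x; ring.
rewrite perturbed0 => C2.
set a := fine (perturbed (fun x => delta * wt x)) in upper C1.
set b := fine (perturbed (fun x => - wt x)) in C1 C2 *.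
have : a + delta * b <= (1 + delta) * fine (P c).
  rewrite -(ler_pM2l l0) mulrA ldl mul1r; lra.
rewrite ler_norml; lra.
Qed.

Let Pcfin : P c \is a fin_num.
Proof. by rewrite -perturbed0 perturbed_fin//; exact: has_growth_cst. Qed.

(** The convex majorant is the loss of value [P c - P (c - h)], which vanishes at [h = 0];
    domination at [- h] is the supergradient inequality at [h]. *)
Lemma perturbed_supergradient : exists l : ('M[R]_(T.+1, d) -> R) -> R,
  (forall a h1 h2, growth h1 -> growth h2 ->
    l (fun x => a * h1 x + h2 x) = a * l h1 + l h2) /\
  (forall h, growth h -> fine (perturbed h) <= fine (P c) + l h).
Proof.
have [||||l [llin lle]] := @hahn_banach_convex R ('M[R]_(T.+1, d) -> R^o) growth
    (fun h => fine (P c) - fine (perturbed (fun x => - h x))).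
- exact: has_growth_cst.
- by move=> a x y gx gy; exact: has_growth_lin.
- move=> h1 h2 a g1 g2 a01.
  have := perturbed_concave _ _ _ (has_growthN _ _ g1) (has_growthN _ _ g2) a01.
  rewrite (_ : (fun x => _ * - _ + _) = (fun x => - (a *: h1 + (1 - a) *: h2) x)).
    by lra.
  by apply/funext => x; transitivity (- (a * h1 x + (1 - a) * h2 x)); first ring.
- rewrite (_ : (fun x => _) = (fun=> 0 : R)); last first.
    by apply/funext => x; rewrite oppr0.
  by rewrite perturbed0 subrr.
exists l; split => [a h1 h2 g1 g2|h gh]; first exact: llin.
have := lle _ (has_growthN _ _ gh) => /=.
have -> : (fun x => - - h x) = h by apply/funext => x; rewrite opprK.
have l0 : l 0 = 0.
  by have := llin (-1) _ _ gh gh; rewrite scaleN1r addNr mulN1r addNr.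
have := llin (-1) _ _ gh (has_growth_cst _ 0 : growth 0).
rewrite scaleN1r addr0 l0 addr0 mulN1r -[- h]/(fun x => - h x) => ->.
lra.
Qed.

(** * From a supergradient at a cost to an optimal measure *)

Section supergradient.
Variable l : ('M[R]_(T.+1, d) -> R) -> R.
Hypothesis llin : forall a h1 h2, growth h1 -> growth h2 ->
  l (fun x => a * h1 x + h2 x) = a * l h1 + l h2.
Hypothesis lsup : forall h, growth h -> fine (perturbed h) <= fine (P c) + l h.

Let l0 : l (fun=> 0) = 0.
Proof.
have gc := has_growth_cst S 0; have := llin (-1) _ _ gc gc.
by rewrite (_ : (fun x => _) = (fun=> 0)); [lra|apply/funext => x; ring].
Qed.

Let lZ a h : growth h -> l (fun x => a * h x) = a * l h.
Proof.
move=> gh; have := llin a _ _ gh (has_growth_cst _ 0); rewrite l0 addr0 => <-.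
by congr l; apply/funext => x; rewrite addr0.
Qed.

Let lN h : growth h -> l (fun x => - h x) = - l h.
Proof.
move=> gh; rewrite -mulN1r -lZ//; congr l.
by apply/funext => x; rewrite mulN1r.
Qed.

Lemma supergradient_ge0 h : growth h -> (forall x, Om K x -> 0 <= h x) ->
  0 <= l h.
Proof.
move=> gh h0; have := lsup _ gh.
have := perturbed_mono _ _ (has_growth_cst _ 0) gh h0.
by rewrite perturbed0; lra.
Qed.

(** By cash additivity, the supergradient inequalities at 1 and at -1 read [1 <= l 1] and
    [l 1 <= 1]. *)
Lemma supergradient_cst1 : l (fun=> 1) = 1.
Proof.
have gc := has_growth_cst S.
have := lsup _ (gc 1); have := lsup _ (has_growthN _ _ (gc 1)).
by rewrite !perturbed_cst lN//; lra.
Qed.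

Lemma supergradient_le0 z : A z -> growth z -> l z <= 0.
Proof.
move=> Az gz; have := lsup _ (has_growthN _ _ gz); rewrite lN//.
suff : fine (P c) <= fine (perturbed (fun x => - z x)) by lra.
apply: fine_le => //; first by apply: perturbed_fin; exact: has_growthN.
rewrite (_ : perturbed _ = P (fun x => c x - (z x)%:E)%E); first exact: Pfrak_subA.
by apply: eq_Pfrak => x _; rewrite addeC.
Qed.

(** Since [payoff p = (payoff p - g) + g] is at most [(payoff p - g) + c], [U p] is bounded by the
    perturbed value at [payoff p - g], to which the supergradient inequality applies. Moving terms
    across, this is the bound of [E_Q[c] + D(Q)] by [P c], for a single [p] and with a minorant [g]
    in place of [c]. *)
Lemma supergradient_dual p g : inEall E p -> growth g ->
  (forall x, Om K x -> ((g x)%:E <= c x)%E) ->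
  (U p <= (fine (P c) + l (payoff p) - l g)%:E)%E.
Proof.
move=> Ep gg gc; have gp := has_growth_payoff _ Ep.
have gh : growth (fun x => -1 * g x + payoff p x) by exact: has_growth_lin.
have := lsup _ gh; rewrite llin// => le1.
apply: (@le_trans _ _ (perturbed (fun x => -1 * g x + payoff p x))).
  apply: U_le_Pfrak => // x Kx.
  apply: (@le_trans _ _ ((-1 * g x + payoff p x)%:E + (g x)%:E)%E).
    by rewrite -EFinD lee_fin; lra.
  by rewrite leeD2l// gc.
by rewrite -(fineK (perturbed_fin _ gh)) lee_fin; lra.
Qed.

Lemma supergradient_tight :
  forall e, 0 < e -> exists u N, [/\ growth u,
    forall x, Om K x -> 0 <= u x,
    forall x, Om K x -> N < wt x -> wt x <= u x & l u < e].
Proof.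
move=> e e0; have [Ef _ _ wf Uf] := ftight.
have gw : growth (fun x => (- C) * wt x).
  by apply: has_growthZ; exact: has_growth_wt.
(* [supergradient_dual] at the position [- G * f n], with the minorant [- C * wt], gives
   [G * l (payoff (f n)) < B] once [U] exceeds -1 there; [G] is chosen so that [B < G * e]. *)
pose B := fine (P c) + 1 + C * l wt.
pose G := (`|B| + 1) / e.
have G0 : 0 < G by rewrite divr_gt0// ltr_wpDl.
have [n Un] := Uf G G0.
have gf := has_growth_payoff _ (Ef n).
exists (payoff (f n)), (M n); split => //.
- by move=> x; exact: payoff_ge0.
- exact: wf.
have Ep : inEall E (oppPhi (scalePhi G (f n))).
  by apply: inEall_opp; exact: inEall_scale.
have := supergradient_dual _ _ Ep gw.
have -> : payoff (oppPhi (scalePhi G (f n))) = fun x => (- G) * payoff (f n) x.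
  by apply/funext => x; rewrite payoff_opp payoff_scale mulNr.
rewrite !lZ//; last exact: has_growth_wt.
move=> le1; have := lt_le_trans Un (le1 _); rewrite lte_fin.
have -> : (forall x, Om K x -> ((- C * wt x)%:E <= c x)%E) = True.
  by apply/propext; split => // _ x Kx; rewrite mulNr; exact: cC.
move=> /(_ I) lt1.
have : G * l (payoff (f n)) < G * e.
  apply: (@lt_le_trans _ _ B); first by rewrite /B; lra.
  by rewrite divfK ?gt_eqF//; have := ler_norm B; lra.
by rewrite ltr_pM2l.
Qed.

Hypothesis clsc : lsc_on S c.

Lemma supergradient_probability : exists Q : probability (Borel R T d) R,
  [/\ Prob1 K Q, polarA A Q & (EQ Q c + DQ E U Q <= P c)%E].
Proof.
have [Q [QS Ql]] := riesz_tight S l Sclosed llin supergradient_ge0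
  supergradient_cst1 supergradient_tight.
have cwt : {within S, continuous wt}.
  by apply: continuous_subspaceT; exact: wt_continuous.
have [iwt lwt] := Ql _ cwt (has_growth_wt S).
have Q1 : Prob1 K Q.
  split => // i j; rewrite (integral_full_set Q S)//.
  have centry : {within S, continuous (fun x : 'M[R]_(T.+1, d) => `|x i j|)}.
    apply: within_continuous_norm; apply: continuous_subspaceT.
    exact: coord_continuous.
  have [|_ ->] := Ql _ centry; last exact: ltry.
  by exists 1 => x _; rewrite mul1r normr_id entry_le_wt.
exists Q; split => // [z Az|].
  have [cz gz] := polar_growth _ Az.
  rewrite (integral_full_set Q S)//; have [_ ->] := Ql _ cz gz.
  by rewrite lee_fin supergradient_le0.
have [h [hc h0 hk hle hcvg]] := lsc_on_approx S c C Sclosed clsc cC.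
have ch k : {within S, continuous (h k)} by exact: continuous_subspaceT.
have h_ge0 k x : 0 <= h k x by have /andP[] := h0 k x.
have gh k : growth (h k).
  exists k%:R => x _; rewrite ger0_norm// (le_trans (hk k x))//.
  by rewrite ler_peMr// wt_ge1.
pose G x : \bar R := (c x + (C * wt x)%:E)%E.
have G0 x : S x -> (0 <= G x)%E.
  by move=> Sx; rewrite /G -leeBlDr// sub0e cC.
have mh k : measurable_fun (S : set (Borel R T d))
    (fun x : 'M[R]_(T.+1, d) => (h k x)%:E : \bar R).
  by apply/measurable_EFinP; exact: borel_within_continuous.
have mG : measurable_fun (S : set (Borel R T d)) G.
  exact: (@emeasurable_fun_cvg _ (Borel R T d) R S
    (fun k (x : 'M[R]_(T.+1, d)) => (h k x)%:E)).
have intG b : (forall k, l (h k) <= b) -> (\int[Q]_(x in S) G x <= b%:E)%E.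
  move=> lb; rewrite (_ : (\int[Q]_(x in S) G x =
      \int[Q]_(x in S) limn (fun k => (h k x)%:E))%E); last first.
    by apply: eq_integral => x; rewrite inE => Sx; apply/esym/cvg_lim => //; exact: hcvg.
  rewrite monotone_convergence//; last first.
    - move=> x Sx; apply: homo_leq => //; first exact: le_trans.
      by move=> k; rewrite lee_fin; have /andP[] := h0 k x.
    - by move=> k x Sx; rewrite lee_fin.
  apply: lime_le; last first.
    by apply: nearW => k; have [_ ->] := Ql _ (ch k) (gh k); rewrite lee_fin.
  apply: ereal_nondecreasing_is_cvgn; apply: homo_leq => //; first exact: le_trans.
  move=> k; apply: ge0_le_integral => //.
    by move=> x Sx; rewrite lee_fin.
  by move=> x Sx; rewrite lee_fin; have /andP[] := h0 k x.
(* The minorants [h k - C * wt] of [c] give a bound on [l (h k)] that does not depend on [k];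
   monotone convergence carries it to [G]. *)
have dual p u : inEall E p -> U p = u%:E ->
    (\int[Q]_(x in S) G x <= (fine (P c) + l (payoff p) - u + C * l wt)%:E)%E.
  move=> Ep Uu; apply: intG => k.
  have gw : growth (fun x => (- C) * wt x).
    by apply: has_growthZ; exact: has_growth_wt.
  have gg : growth (fun x => (- C) * wt x + h k x).
    by apply: has_growth_lin => //; exact: has_growth_wt.
  have := supergradient_dual _ _ Ep gg.
  rewrite Uu llin//; last exact: has_growth_wt.
  rewrite lee_fin => H; suff /H : forall x, S x ->
    ((- C * wt x + h k x)%:E <= c x)%E by lra.
  by move=> x Sx; rewrite addrC mulNr EFinB leeBlDr// hle.
have [u0 Uu0] : exists u, U zeroPhi = u%:E.
  by exists (fine (U zeroPhi)); rewrite fineK.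
(* The zero position, where [U] is finite, makes [G] integrable. Hence [EQ Q c] is real and can be
   moved across the inequality for every other [p]. *)
have Gfin : (\int[Q]_(x in S) G x < +oo)%E.
  by apply: le_lt_trans (dual _ _ inEall_zero Uu0) _; exact: ltry.
have iG : Q.-integrable S G.
  apply/integrableP; split => //.
  rewrite (_ : (\int[Q]_(x in S) _ = \int[Q]_(x in S) G x)%E)//.
  by apply: eq_integral => x; rewrite inE => Sx; rewrite gee0_abs// G0.
pose v := fine (\int[Q]_(x in S) G x).
have vE : (\int[Q]_(x in S) G x = v%:E)%E.
  by rewrite fineK//; exact: integrable_fin_num.
have EQc : EQ Q c = (v - C * l wt)%:E.
  rewrite /EQ (integral_full_set Q S)// EFinB -vE EFinM -lwt -integralZl//.
  rewrite -integralB//; last exact: integrableZl.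
  by apply: eq_integral => x _; rewrite -EFinM /G addeK.
have DQle : (DQ E U Q <= (fine (P c) - v + C * l wt)%:E)%E.
  apply: ge_ereal_sup => _ [p Ep <-].
  rewrite sum_EQ_payoff//.
  have [_ ->] := Ql _ (continuous_payoff _ Ep) (has_growth_payoff _ Ep).
  have := Uconc.1 _ Ep; case Up : (U p) => [u| |] // _; last by rewrite addNye leNye.
  have := dual _ _ Ep Up; rewrite vE -EFinB !lee_fin; lra.
rewrite EQc -(fineK Pcfin); apply: le_trans (leeD (lexx _) DQle) _.
by rewrite -EFinD lee_fin; lra.
Qed.

End supergradient.
Lemma dual_attained : lsc_on S c -> exists Q : probability (Borel R T d) R,
  [/\ Prob1 K Q, polarA A Q & P c = (EQ Q c + DQ E U Q)%E].
Proof.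
move=> clsc; have [l [llin lsup]] := perturbed_supergradient.
have [Q [Q1 QA Qle]] := supergradient_probability l llin lsup clsc.
exists Q; split => //; apply/eqP; rewrite eq_le Qle andbT.
exact: weak_duality.
Qed.

End perturbation.
End market.

(** * From condition (ii) to tightness, and conclusion *)

Lemma wt_bounded_on_compact_rows {R : realType} {m d : nat}
    (B : 'I_m -> set 'rV[R]_d) : (forall t, compact (B t)) ->
  exists2 M : R, 0 <= M &
    forall x : 'M[R]_(m, d), (forall t, B t (row t x)) -> wt x <= M.
Proof.
move=> Bc.
have /choice[b bP] t : exists b : R, forall v, B t v -> `|v| <= b.
  have [r [_ rP]] := compact_bounded (Bc t).
  by exists (r + 1) => v Bv; apply: (rP (r + 1)) => //; rewrite ltrDl.
exists (1 + \sum_(t < m) \sum_(j < d) `|b t|).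
  by rewrite addr_ge0//; apply: sumr_ge0 => t _; exact: sumr_ge0.
move=> x Bx; rewrite lerD2l; apply: ler_sum => t _; apply: ler_sum => j _.
have := entry_le_norm (row t x) ord0 j; rewrite mxE => /le_trans; apply.
by apply: le_trans (bP t _ (Bx t)) _; exact: ler_norm.
Qed.

(** [M n] bounds [wt] on the product of the compact sets, so [wt x > M n] puts [x] outside it.
    Convergence of [V] to 0 gives an index with [V < 1], that is [U > -1] at the opposite position;
    the constant 1 becomes small after division by [G] in [supergradient_tight]. *)
Lemma tight_family_exists {R : realType} {d T : nat}
    (K : 'I_T.+1 -> 'I_d -> set R)
    (E : forall t : 'I_T.+1, set ('M[R]_(t.+1, d) -> R))
    (U : Phi R T d -> \bar R) (Kc : 'I_T.+1 -> nat -> set 'rV[R]_d)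
    (f : nat -> Phi R T d) :
  (forall t n, compact (Kc t n)) -> (forall n, inEall E (f n)) ->
  (forall n (t : 'I_T.+1) y, Omt K t.+1 y -> 0 <= f n t y) ->
  (forall n x, Om K x -> ~ (forall t, Kc t n (row t x)) ->
    wt x <= \sum_(t < T.+1) f n t (projt t x)) ->
  (forall G : R, 0 < G -> (fun n => Vof U (scalePhi G (f n))) @ \oo --> 0%E) ->
  exists M, tight_family K E U f M.
Proof.
move=> cK Ef f0 wf V0.
have /choice[M MP] n : exists M : R, 0 <= M /\
    forall x : 'M[R]_(T.+1, d), (forall t, Kc t n (row t x)) -> wt x <= M.
  have [M M0 wM] := wt_bounded_on_compact_rows (Kc^~ n) (fun t => cK t n).
  by exists M.
exists M; split => //.
- by move=> n; exact: (MP n).1.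
- move=> n x Kx Mx; apply: wf => // /(MP n).2.
  by rewrite leNgt Mx.
- move=> G /V0/fine_cvgP[Vfin /cvgr_lt/(_ 1 ltr01) V1].
  have [n [/= nfin n1]] := filter_ex (filterI Vfin V1).
  have : (Vof U (scalePhi G (f n)) < 1%:E)%E by rewrite -(fineK nfin) lte_fin.
  by exists n; rewrite EFinN -lteNl.
Qed.

Lemma Bw_growth {R : realType} {T d : nat} (K : 'I_T.+1 -> 'I_d -> set R) c :
  Bw K c -> has_growth (Om K) c.
Proof. by case. Qed.

Lemma has_growth_lower {R : realType} {m d : nat} (S : set 'M[R]_(m, d)) c :
  has_growth S c -> exists C, forall x, S x -> ((- (C * wt x))%:E <= (c x)%:E)%E.
Proof.
move=> [C cC]; exists C => x /cC; rewrite ler_norml lee_fin.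
by move=> /andP[].
Qed.

Theorem theorem2p11 (R : realType) (d T : nat)
    (K : 'I_T.+1 -> 'I_d -> set R)
    (E : forall t : 'I_T.+1, set ('M[R]_(t.+1, d) -> R))
    (U : Phi R T d -> \bar R) (A : set ('M[R]_(T.+1, d) -> R)) :
  (1 <= d)%N -> (1 <= T)%N ->
  (forall t j, closed (K t j)) ->
  good_E K E ->
  (* (i) *)
  concave_U E U -> U zeroPhi \is a fin_num ->
  convex_cone A -> A `<=` Cw (Om K) ->
  (* (ii) *)
  (exists (Kc : 'I_T.+1 -> nat -> set 'rV[R]_d) (f : nat -> Phi R T d),
     (forall t n, compact (Kc t n)) /\
     (forall t n v, Kc t n v -> forall j, K t j (v ord0 j)) /\
     (forall n, inEall E (f n)) /\
     (forall n (t : 'I_T.+1) y, Omt K t.+1 y -> 0 <= f n t y) /\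
     (forall n x, Om K x -> ~ (forall t, Kc t n (row t x)) ->
        wt x <= \sum_(t < T.+1) f n t (projt t x)) /\
     (forall G : R, 0 < G ->
        (fun n => Vof U (scalePhi G (f n))) @ \oo --> 0%E)) ->
  (* (a) *)
  ((exists2 ch, Bw K ch & (Pfrak K E U A (fun x => (ch x)%:E) < +oo)%E) ->
     let P := fun c : 'M[R]_(T.+1, d) -> R =>
                Pfrak K E U A (fun x => (c x)%:E) in
     (forall c, Bw K c -> P c \is a fin_num) /\
     (forall c, Bw K c -> forall e : R, 0 < e -> exists2 del : R, 0 < del &
        forall c', Bw K c' -> (wnorm K (c' \- c)%R < del%:E)%E ->
          `|fine (P c') - fine (P c)| < e) /\
     (forall c, Bw K c -> forall k : R,
        P (fun x => c x + k) = (P c + k%:E)%E) /\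
     (forall c c' (l : R), Bw K c -> Bw K c' -> 0 <= l <= 1 ->
        (l%:E * P c + (1 - l)%:E * P c' <=
         P (fun x => (l * c x + (1 - l) * c' x)%R))%E) /\
     (forall c c', Bw K c -> Bw K c' -> (forall x, Om K x -> c x <= c' x) ->
        (P c <= P c')%E)) /\
  (* (b) *)
  (forall c : 'M[R]_(T.+1, d) -> \bar R,
     (forall x, Om K x -> c x != -oo%E) ->
     lsc_on (Om K) c ->
     (exists2 a : R, 0 <= a & forall x, Om K x -> (- ((a * wt x)%R)%:E <= c x)%E) ->
     Pfrak K E U A c =
       ereal_inf [set (EQ Q c + DQ E U Q)%E
                 | Q in [set Q : probability (Borel R T d) R |
                          Prob1 K Q /\ polarA A Q]] /\
     ((Pfrak K E U A c < +oo)%E ->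
        exists Q : probability (Borel R T d) R,
          [/\ Prob1 K Q, polarA A Q &
              Pfrak K E U A c = (EQ Q c + DQ E U Q)%E])).
Proof.
move=> _ _ Kcl Egood Uconc U0 Acone Acont.
move=> [Kc [f [cK [_ [Ef [f0 [wf V0]]]]]]].
have [M tf] := tight_family_exists K E U Kc f cK Ef f0 wf V0.
split.
  move=> [ch Bch Pch] P.
  have [Ch chC] := has_growth_lower _ _ (Bw_growth K _ Bch).
  have Pfin c : has_growth (Om K) c -> P c \is a fin_num.
    move=> gc; rewrite /P.
    (* [c] is regarded as the perturbation [c - ch] of [ch], so finiteness spreads from [ch]. *)
    have gd : has_growth (Om K) (fun x => -1 * ch x + c x).
      by apply: has_growth_lin => //; exact: Bw_growth.
    have := perturbed_fin K E U A Egood Uconc Acone f M tf _ Ch chC Pch _ gd.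
    congr (_ \is a fin_num); apply: eq_Pfrak => // x _.
    by rewrite -EFinD; congr EFin; ring.
  have Plt c : has_growth (Om K) c -> (P c < +oo)%E.
    by move=> /Pfin; rewrite fin_numElt => /andP[].
  split; first by move=> c /Bw_growth; exact: Pfin.
  split.
    move=> c /Bw_growth gc e e0.
    have [C cC] := has_growth_lower _ _ gc.
    pose D := fine (P c) -
      fine (perturbed K E U A (fun x => (c x)%:E) (fun x => - wt x)).
    (* [D] is the constant of [perturbed_lipschitz]; the 1 added to [|D|] avoids a zero denominator
       and makes the final bound strict, and [2^-1] keeps [delta] below 1. *)
    pose delta := Num.min 2^-1 (e / (`|D| + 1)).
    have D1 : 0 < `|D| + 1 by rewrite ltr_wpDl.
    have delta0 : 0 < delta by rewrite lt_min invr_gt0 ltr0n/= divr_gt0.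
    have delta1 : delta < 1.
      by rewrite gt_min; apply/orP; left; have /andP[] := @half_gt0_lt1 R.
    have deltae : delta * (`|D| + 1) <= e.
      by rewrite -ler_pdivlMr// ge_min lexx orbT.
    exists delta => // c' /Bw_growth gc' cc'.
    have gd : has_growth (Om K) (fun x => -1 * c x + c' x).
      exact: has_growth_lin.
    have := perturbed_lipschitz K E U A Egood Uconc Acone f M tf _ C cC
      (Plt _ gc) _ delta gd.
    rewrite delta0 delta1 => /(_ isT).
    have -> : perturbed K E U A (fun x => (c x)%:E) (fun x => -1 * c x + c' x) = P c'.
      by apply: eq_Pfrak => // x _; rewrite -EFinD; congr EFin; ring.
    rewrite -/P -/D => H; apply: (@le_lt_trans _ _ (delta * D)).
      apply: H => x Kx.
      have : ((`|(c' \- c) x| / wt x)%:E < delta%:E)%E.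
        by apply: le_lt_trans cc'; apply: ereal_sup_ubound; exists x.
      rewrite lte_fin ltr_pdivrMr; last exact: lt_le_trans (wt_ge1 x).
      by move=> /ltW; rewrite /= mulN1r addrC.
    apply: lt_le_trans deltae; rewrite ltr_pM2l//.
    by have := ler_norm D; lra.
  split.
    by move=> c _ k; rewrite /P -Pfrak_cash_additive.
  split; last by move=> c c' _ _ cc'; apply: le_Pfrak => // x Kx; rewrite lee_fin cc'.
  move=> c c' l /Bw_growth gc /Bw_growth gc' /andP[l0 l1].
  have [->|ln0] := eqVneq l 0.
    rewrite mul0e add0e subr0 mul1e le_eqVlt; apply/orP; left; apply/eqP.
    by congr P; apply/funext => x; ring.
  have [->|ln1] := eqVneq l 1.
    rewrite subrr mul0e adde0 mul1e le_eqVlt; apply/orP; left; apply/eqP.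
    by congr P; apply/funext => x; ring.
  have l01 : 0 < l < 1 by rewrite !lt_neqAle eq_sym ln0 l0 ln1.
  have g0 := has_growth_cst (Om K) 0.
  have [C0 zC] := has_growth_lower _ _ g0.
  (* Around the zero cost, the perturbed value is [P] itself, so [perturbed_concave] is its
     concavity. *)
  have pE g : perturbed K E U A (fun=> 0%:E) g = P g.
    by apply: eq_Pfrak => // x _; rewrite adde0.
  have := perturbed_concave K E U A Egood Uconc Acone f M tf _ C0 zC (Plt _ g0)
    _ _ _ gc gc' l01.
  have gl : has_growth (Om K) (fun x => l * c x + (1 - l) * c' x).
    by apply: has_growth_lin => //; exact: has_growthZ.
  rewrite !pE => H.
  rewrite -(fineK (Pfin _ gc)) -(fineK (Pfin _ gc')) -(fineK (Pfin _ gl)).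
  by rewrite -!EFinM -EFinD lee_fin.
move=> c _ clsc [a a0 ca].
have weak : (Pfrak K E U A c <= ereal_inf [set (EQ Q c + DQ E U Q)%E
    | Q in [set Q : probability (Borel R T d) R | Prob1 K Q /\ polarA A Q]])%E.
  by apply: le_ereal_inf_tmp => _ [Q [Q1 QA] <-]; exact: weak_duality.
have attained : (Pfrak K E U A c < +oo)%E ->
    exists Q : probability (Borel R T d) R,
      [/\ Prob1 K Q, polarA A Q & Pfrak K E U A c = (EQ Q c + DQ E U Q)%E].
  move=> Pc.
  exact: (dual_attained K E U A Egood Uconc U0 Acone Kcl Acont f M tf c a ca).
split => //; apply/eqP; rewrite eq_le weak /=.
(* At the value [+oo], the equality is already forced by weak duality. *)
have [/attained[Q [Q1 QA ->]]|] := ltP (Pfrak K E U A c) +oo%E.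
  by apply: ereal_inf_lbound; exists Q.
by apply: le_trans; exact: leey.
Qed.
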